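(* Fix a sign $\pm\in\{+,-\}$. Let $R>\hat R:=16\,e^{(2e)^{-1}}$ and $T>0$. Then there exists a number $\hat C>0$ such that for all pairs of functions $(y^0,y^1),(\widetilde y^0,\widetilde y^1)\in(\mathcal R_{R,\hat C})^2$ which are odd with respect to $0$, there exist functions $y\in G^{1,2}([0,1]\times[0,T])$ and $v,w\in G^2([0,T])$ satisfying $$\partial_t^2y=\pm\partial_x^4y+\partial_x^2y-\partial_x(y^2),\quad x\in[0,1],\ t\in[0,T],$$ $$y(0,t)=0,\quad y(1,t)=v(t),\quad \partial_x^2y(0,t)=0,\quad \partial_x^2y(1,t)=w(t),\quad t\in[0,T],$$ $$y(x,0)=y^0(x),\quad \partial_ty(x,0)=y^1(x),\quad x\in[0,1],$$ together with $y(x,T)=\widetilde y^0(x)$ and $\partial_ty(x,T)=\widetilde y^1(x)$ for all $x\in[0,1]$.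
   Context: All functions are real-valued. $\mathcal R_{R,C}$ ($R>1$, $C>0$): functions $z$ on $[-1,1]$ for which there is a sequence $(\alpha_n)_{n\ge0}$ with $|\alpha_n|\le C\,n!/R^n$ for all $n$ and $z(x)=\sum_{n\ge0}\alpha_nx^n/n!$ for all $x\in[-1,1]$. Gevrey classes: $h\in G^s([t_1,t_2])$ if $h\in C^\infty$ and $|h^{(p)}(t)|\le C(p!)^s/R^p$ for some $C,R>0$ and all $p\in\mathbb N$, $t\in[t_1,t_2]$. $y\in G^{s_1,s_2}([x_1,x_2]\times[t_1,t_2])$ if $y\in C^\infty$ and $|\partial_x^{p_1}\partial_t^{p_2}y(x,t)|\le C(p_1!)^{s_1}(p_2!)^{s_2}/(R_1^{p_1}R_2^{p_2})$ for some $C,R_1,R_2>0$, all $(x,t)$ and all $p_1,p_2\in\mathbb N$. *)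

(* Defs.v *)
From Stdlib Require Import Reals Factorial Lra.
From Coquelicot Require Import Coquelicot.
Open Scope R_scope.

Definition seg (a b x : R) : Prop := a <= x <= b.

Definition box (x1 x2 t1 t2 : R) (p : R * R) : Prop :=
  seg x1 x2 (fst p) /\ seg t1 t2 (snd p).

(* Derivatives on a closed interval are those of the restriction to it,
   hence one-sided at the end points. *)
Definition ex_derive_on (a b : R) (f : R -> R) (x : R) : Prop :=
  exists l : R, D_in f (fun _ => l) (seg a b) x.

(* A junk value where the derivative does not exist; see [derive_on_unique]. *)
Definition derive_on (a b : R) (f : R -> R) (x : R) : R :=
  iota (fun l : R => D_in f (fun _ => l) (seg a b) x).

Definition derive_n_on (a b : R) (n : nat) (f : R -> R) : R -> R :=
  Nat.iter n (derive_on a b) f.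

Definition partial_x (x1 x2 : R) (y : R -> R -> R) : R -> R -> R :=
  fun x t => derive_on x1 x2 (fun u => y u t) x.

Definition partial_t (t1 t2 : R) (y : R -> R -> R) : R -> R -> R :=
  fun x t => derive_on t1 t2 (fun s => y x s) t.

Definition partial_n_x (x1 x2 : R) (n : nat) (y : R -> R -> R) : R -> R -> R :=
  Nat.iter n (partial_x x1 x2) y.

Definition partial_n_t (t1 t2 : R) (n : nat) (y : R -> R -> R) : R -> R -> R :=
  Nat.iter n (partial_t t1 t2) y.

Definition smooth_on (a b : R) (f : R -> R) : Prop :=
  forall (n : nat) (x : R), seg a b x -> ex_derive_on a b (derive_n_on a b n f) x.

Fixpoint Ck_box (x1 x2 t1 t2 : R) (k : nat) (y : R -> R -> R) : Prop :=
  continuous_on (box x1 x2 t1 t2) (fun p : R * R => y (fst p) (snd p)) /\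
  match k with
  | O => True
  | S k' =>
      (forall x t, seg x1 x2 x -> seg t1 t2 t ->
         ex_derive_on x1 x2 (fun u => y u t) x /\
         ex_derive_on t1 t2 (fun s => y x s) t) /\
      Ck_box x1 x2 t1 t2 k' (partial_x x1 x2 y) /\
      Ck_box x1 x2 t1 t2 k' (partial_t t1 t2 y)
  end.

Definition smooth_box (x1 x2 t1 t2 : R) (y : R -> R -> R) : Prop :=
  forall k : nat, Ck_box x1 x2 t1 t2 k y.

Definition gevrey (s t1 t2 : R) (h : R -> R) : Prop :=
  smooth_on t1 t2 h /\
  exists M r : R, 0 < M /\ 0 < r /\
    forall (p : nat) (t : R), seg t1 t2 t ->
      Rabs (derive_n_on t1 t2 p h t) <= M * Rpower (INR (fact p)) s / r ^ p.

Definition gevrey2 (s1 s2 x1 x2 t1 t2 : R) (y : R -> R -> R) : Prop :=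
  smooth_box x1 x2 t1 t2 y /\
  exists M r1 r2 : R, 0 < M /\ 0 < r1 /\ 0 < r2 /\
    forall (p1 p2 : nat) (x t : R), seg x1 x2 x -> seg t1 t2 t ->
      Rabs (partial_n_x x1 x2 p1 (partial_n_t t1 t2 p2 y) x t)
      <= M * Rpower (INR (fact p1)) s1 * Rpower (INR (fact p2)) s2
           / (r1 ^ p1 * r2 ^ p2).

Definition class_R (r c : R) (z : R -> R) : Prop :=
  exists alpha : nat -> R,
    (forall n : nat, Rabs (alpha n) <= c * INR (fact n) / r ^ n) /\
    (forall x : R, seg (-1) 1 x ->
       is_series (fun n : nat => alpha n * x ^ n / INR (fact n)) (z x)).

Definition odd_on (z : R -> R) : Prop :=
  forall x : R, seg (-1) 1 x -> z (- x) = - z x.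

Definition R_hat : R := 16 * exp (/ (2 * exp 1)).

Lemma derive_on_unique (a b : R) (f : R -> R) (x l : R) :
  a < b -> seg a b x -> D_in f (fun _ => l) (seg a b) x -> derive_on a b f x = l.
Proof.
intros hab [hax hxb] hl.
unfold derive_on.
apply (iota_unique (fun l : R => D_in f (fun _ => l) (seg a b) x)); [|exact hl].
intros l' hl'.
refine (single_limit _ _ _ _ x _ hl' hl).
intros e he.
destruct (Rlt_or_le x b) as [h|h].
- exists (x + Rmin (e / 2) (b - x)).
  assert (h1 := Rmin_l (e / 2) (b - x)). assert (h2 := Rmin_r (e / 2) (b - x)).
  assert (h3 : 0 < Rmin (e / 2) (b - x)) by (apply Rmin_glb_lt; lra).
  unfold D_x, seg; split; [lra|]. unfold Rdist. rewrite Rabs_pos_eq; lra.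
- exists (x - Rmin (e / 2) (x - a)).
  assert (h1 := Rmin_l (e / 2) (x - a)). assert (h2 := Rmin_r (e / 2) (x - a)).
  assert (h3 : 0 < Rmin (e / 2) (x - a)) by (apply Rmin_glb_lt; lra).
  unfold D_x, seg; split; [lra|]. unfold Rdist. rewrite Rabs_left; lra.
Qed.

(* Main.v *)
Require Import Defs.
From Stdlib Require Import Reals Factorial Lra Lia FunctionalExtensionality.
From Coquelicot Require Import Coquelicot.
Open Scope R_scope.

(** The equation is solved as an evolution in [x].  For an odd solution
[y = sum_n A_n(t) x^n / n!] the equation says that
[[
  A_(n+4) = sg * (A_n'' - A_(n+2) + conv_n(A)),
]]
where [conv_n(A)] is the n-th coefficient of [2 y (dy/dx)], so that [y] is determined
by its two traces [A_1] and [A_3] at [x = 0], while [A_0 = A_2 = 0].  The boundary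
controls [v] and [w] are then read off from [y].  It remains to choose [A_1] and
[A_3] on [seg 0 T] so that the initial and the final states come out right.

At [t = 0] the same recursion, solved for [A_n''], goes up in time: the Taylor
coefficients of the two initial functions give all numbers [d n m], the expected
values of the derivatives of order [n] in [x] and [m] in [t] at the point [(0, 0)]
([jets_exist]).  Conversely, as soon as the derivatives of [A_1] and [A_3] at [0] are
the numbers [d 1 m] and [d 3 m], the recursion forces [A n m = d n m] at [t = 0] for
all [n] and [m] ([jet_relation_unique]), and the power series at [t = 0] is the one
of the data.  The final time is treated in the same way.  So the theorem follows
from three estimates, organized around the majorant [e (n + 2m)! / (X^n Z^m)], in which
two time derivatives weigh as much as four space derivatives:

- the jets of the data satisfy it ([jets_exist]);
- there are functions of Gevrey order 2 on [seg 0 T] with given jets at both ends, and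
  the loss in the constant [Z] is explicit ([two_point_borel_gevrey2]);
- the recursion in [x] propagates it ([cauchy_problem]), and when [X > 1] the power
  series converges together with all its derivatives for [|x| <= 1].

The majorant is stable because each lower-order term gains factorials: the second
derivative in [x] gains two of them, which is a small numerical factor, and the
quadratic term gains three, of which two absorb the number [(n + 1)(m + 1)] of terms
in the Leibniz formula ([conv_bound]); what remains of the quadratic term is made
small by [e], that is, by the size of the data.

The constants chain as follows.  As [R_hat >= 18], the data have [X = 18], for which
the jets have [Z = 75]; passing from the factorials [(2m + 3)!] to [(2m)!] costs a bit
of [Z] and leaves [72]; the realization of the jets brings [Z] down to [4/3]; and this
is enough for the recursion in [x] to run with [X = 21/20]. *)

(** * Towers of derivatives on a set *)

(** Derivatives of all orders are carried along as an explicit sequence, so that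
bounds on them are available before any of them is known to be [derive_n_on]. *)
Definition tower (D : R -> Prop) (f : nat -> R -> R) : Prop :=
  forall n x, D x -> D_in (f n) (f (S n)) D x.

(** The second-order Taylor estimate is the form in which
differentiability passes to infinite sums: it can be added term by term. *)
Lemma D_in_of_quadratic (D : R -> Prop) (f : R -> R) (x l M : R) :
  (forall s, D s -> Rabs (f s - f x - (s - x) * l) <= M * (s - x) ^ 2) ->
  D_in f (fun _ => l) D x.
Proof.
intros H e he.
exists (e / (Rabs M + 1)).
assert (hM := Rabs_pos M). assert (hM' := Rle_abs M).
split. { apply Rdiv_lt_0_compat; lra. }
intros s [[hs hne] hd].
assert (hs0 : s - x <> 0) by lra.
assert (hp : 0 < Rabs (s - x)) by now apply Rabs_pos_lt.
simpl in hd |- *. unfold Rdist in hd |- *.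
replace ((f s - f x) / (s - x) - l) with ((f s - f x - (s - x) * l) / (s - x))
  by (field; lra).
unfold Rdiv at 1. rewrite Rabs_mult, Rabs_inv.
apply Rle_lt_trans with (Rabs M * Rabs (s - x)).
- apply Rmult_le_reg_r with (Rabs (s - x)); [lra|].
  rewrite Rmult_assoc, Rinv_l by lra.
  rewrite Rmult_1_r. apply Rle_trans with (1 := H s hs).
  rewrite <- (pow2_abs (s - x)). nra.
- apply Rle_lt_trans with ((Rabs M + 1) * Rabs (s - x)); [nra|].
  apply Rmult_lt_compat_l with (r := Rabs M + 1) in hd; [|lra].
  replace ((Rabs M + 1) * (e / (Rabs M + 1))) with e in hd by (field; lra).
  lra.
Qed.

Lemma D_in_subset (D D' : R -> Prop) (f g : R -> R) (x : R) :
  (forall s, D' s -> D s) -> D_in f g D x -> D_in f g D' x.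
Proof.
intros h H. unfold D_in in *.
apply limit1_imp with (D := D_x D x); [|exact H].
intros s [hs hn]. split; auto.
Qed.

Lemma D_in_congr (D : R -> Prop) (f f' : R -> R) (l l' x : R) :
  D x -> (forall s, D s -> f s = f' s) -> l = l' ->
  D_in f (fun _ => l) D x -> D_in f' (fun _ => l') D x.
Proof.
intros hx h <- H e he. destruct (H e he) as [d [hd Hd]].
exists d; split; auto. intros s [hs1 hs2].
rewrite <- (h s), <- (h x); auto. apply hs1.
Qed.

Lemma D_in_at (D : R -> Prop) (f g : R -> R) (x : R) :
  D_in f g D x <-> D_in f (fun _ => g x) D x.
Proof. split; exact (fun H => H). Qed.

Lemma D_in_of_is_derive (D : R -> Prop) (f : R -> R) (x l : R) :
  is_derive f x l -> D_in f (fun _ => l) D x.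
Proof.
intros H. apply is_derive_Reals in H. intros e he.
destruct (H e he) as [d Hd]. exists d. split; [apply cond_pos|].
intros s [[hs hne] hd]. simpl in *. unfold Rdist in *.
specialize (Hd (s - x)).
replace (x + (s - x)) with s in Hd by ring. apply Hd; lra.
Qed.

Lemma is_derive_of_D_in (a b : R) (f : R -> R) (x l : R) :
  a < x < b -> D_in f (fun _ => l) (seg a b) x -> is_derive f x l.
Proof.
intros hx H. apply is_derive_Reals. intros e he.
destruct (H e he) as [d [hd Hd]].
assert (hm : 0 < Rmin d (Rmin (x - a) (b - x))) by (repeat apply Rmin_glb_lt; lra).
exists (mkposreal _ hm). simpl. intros h hn hh.
assert (h1 := Rmin_l d (Rmin (x - a) (b - x))).
assert (h2 := Rmin_r d (Rmin (x - a) (b - x))).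
assert (h3 := Rmin_l (x - a) (b - x)).
assert (h4 := Rmin_r (x - a) (b - x)).
assert (h5 := Rabs_def2 _ _ hh).
specialize (Hd (x + h)). simpl in Hd. unfold Rdist in Hd.
replace (x + h - x) with h in Hd by ring. apply Hd.
split; [|lra]. split; [unfold seg; lra|]. lra.
Qed.

(** The retraction onto [seg a b]; composing with it turns a function which is
continuous on the segment into one which is continuous on the whole line. *)
Definition clamp (a b x : R) : R := Rmax a (Rmin b x).

Lemma clamp_seg (a b x : R) : a <= b -> seg a b (clamp a b x).
Proof.
intros h. unfold clamp, seg. unfold Rmax, Rmin.
repeat destruct Rle_dec; lra.
Qed.

Lemma clamp_id (a b x : R) : seg a b x -> clamp a b x = x.
Proof.
intros h. unfold seg in h. unfold clamp, Rmax, Rmin.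
repeat destruct Rle_dec; lra.
Qed.

Lemma clamp_lip (a b x x' : R) : Rabs (clamp a b x - clamp a b x') <= Rabs (x - x').
Proof.
unfold clamp, Rmax, Rmin, Rabs.
repeat destruct Rle_dec; repeat destruct Rcase_abs; lra.
Qed.

Lemma D_in_continuous (a b : R) (f : R -> R) (x l : R) :
  seg a b x -> D_in f (fun _ => l) (seg a b) x ->
  forall e, 0 < e -> exists d, 0 < d /\
    forall s, seg a b s -> Rabs (s - x) < d -> Rabs (f s - f x) < e.
Proof.
intros hx H e he. apply cont_deriv in H.
destruct (H e he) as [d [hd Hd]]. exists d; split; auto.
intros s hs hsx.
destruct (Req_dec x s) as [->|n].
- unfold Rminus; rewrite Rplus_opp_r, Rabs_R0; auto.
- apply (Hd s). split; auto. split; auto.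
Qed.

(** The mean value theorem for one-sided derivatives at the end points,
obtained from the usual one for the function composed with [clamp]. *)
Lemma lipschitz_of_D_in (a b : R) (f g : R -> R) (M : R) :
  (forall x, seg a b x -> D_in f g (seg a b) x) ->
  (forall x, seg a b x -> Rabs (g x) <= M) ->
  forall s t, seg a b s -> seg a b t -> Rabs (f s - f t) <= M * Rabs (s - t).
Proof.
intros Hd Hb s t hs ht.
assert (hab : a <= b) by (unfold seg in *; lra).
destruct (MVT_gen (fun x => f (clamp a b x)) t s g) as [c [hc He]].
- intros x hx.
  assert (hx' : a < x < b).
  { unfold seg in *. revert hx. unfold Rmin, Rmax. repeat destruct Rle_dec; lra. }
  apply is_derive_ext_loc with f.
  + assert (hp : 0 < Rmin (x - a) (b - x)) by (apply Rmin_glb_lt; lra).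
    exists (mkposreal _ hp). intros z hz.
    assert (h1 := Rmin_l (x - a) (b - x)). assert (h2 := Rmin_r (x - a) (b - x)).
    assert (h5 := Rabs_def2 _ _ hz). simpl in h5.
    rewrite clamp_id; auto. unfold seg.
    unfold minus, plus, opp in h5; simpl in h5. lra.
  + apply is_derive_of_D_in with a b; auto.
    apply D_in_at with (1 := Hd x ltac:(unfold seg; lra)).
- intros x _ e he.
  destruct (D_in_continuous a b f (clamp a b x) (g (clamp a b x)) (clamp_seg a b x hab)
    (Hd _ (clamp_seg a b x hab)) e he) as [d [hd Hd']].
  exists d; split; auto. intros z [_ hz]. simpl in *. unfold Rdist in *.
  apply Hd'. { now apply clamp_seg. }
  apply Rle_lt_trans with (1 := clamp_lip a b z x). exact hz.
- cbv beta in He. rewrite !clamp_id in He by auto. rewrite He, Rabs_mult.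
  apply Rmult_le_compat_r; [apply Rabs_pos|]. apply Hb.
  unfold seg in *. revert hc. unfold Rmin, Rmax. repeat destruct Rle_dec; lra.
Qed.

(** The mean value inequality for [f - f1(t) * id], whose derivative is at most
[M |s - t|] between [s] and [t]. *)
Lemma taylor_bound (a b : R) (f f1 f2 : R -> R) (M : R) :
  (forall x, seg a b x -> D_in f f1 (seg a b) x) ->
  (forall x, seg a b x -> D_in f1 f2 (seg a b) x) ->
  (forall x, seg a b x -> Rabs (f2 x) <= M) ->
  forall s t, seg a b s -> seg a b t ->
    Rabs (f s - f t - (s - t) * f1 t) <= M * (s - t) ^ 2.
Proof.
intros H1 H2 HM s t hs ht.
assert (hsub : forall z, seg (Rmin s t) (Rmax s t) z -> seg a b z).
{ intros z hz. unfold seg in *. revert hz.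
  unfold Rmin, Rmax. repeat destruct Rle_dec; lra. }
replace (f s - f t - (s - t) * f1 t) with
  ((f s - f1 t * s) - (f t - f1 t * t)) by ring.
apply Rle_trans with (M * Rabs (s - t) * Rabs (s - t)).
2: { rewrite <- (pow2_abs (s - t)). right; ring. }
apply (lipschitz_of_D_in (Rmin s t) (Rmax s t) (fun z => f z - f1 t * z)
   (fun z => f1 z - f1 t * 1)).
- intros x hx. apply Dminus.
  + apply D_in_subset with (seg a b); auto.
  + apply Dmult_const. apply Dx.
- intros x hx. rewrite Rmult_1_r.
  apply Rle_trans with (M * Rabs (x - t)).
  + apply (lipschitz_of_D_in a b f1 f2); auto.
  + apply Rmult_le_compat_l.
    * apply Rle_trans with (2 := HM _ hs). apply Rabs_pos.
    * unfold seg in hx. revert hx. unfold Rmin, Rmax, Rabs.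
      repeat destruct Rle_dec; repeat destruct Rcase_abs; lra.
- unfold seg. split; [apply Rmin_l | apply Rmax_l].
- unfold seg. split; [apply Rmin_r | apply Rmax_r].
Qed.

Lemma ex_series_of_bound (u B : nat -> R) :
  (forall n, Rabs (u n) <= B n) -> ex_series B -> ex_series u.
Proof. exact (@ex_series_le R_AbsRing R_CompleteNormedModule u B). Qed.

Lemma Rabs_Series_le (u B : nat -> R) :
  (forall n, Rabs (u n) <= B n) -> ex_series B -> Rabs (Series u) <= Series B.
Proof.
intros h H. apply Rle_trans with (Series (fun n => Rabs (u n))).
- apply Series_Rabs. apply ex_series_of_bound with B; auto.
  intros n. now rewrite Rabs_Rabsolu.
- apply Series_le; auto. intros n; split; [apply Rabs_pos|auto].
Qed.

(** Summable bounds on the second derivatives give a summable Taylor remainder,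
and this makes the sum differentiable without any uniform convergence argument. *)
Lemma D_in_Series (a b : R) (f f1 f2 : nat -> R -> R) (B B1 B2 : nat -> R) :
  (forall n x, seg a b x -> D_in (f n) (f1 n) (seg a b) x) ->
  (forall n x, seg a b x -> D_in (f1 n) (f2 n) (seg a b) x) ->
  (forall n x, seg a b x -> Rabs (f n x) <= B n) -> ex_series B ->
  (forall n x, seg a b x -> Rabs (f1 n x) <= B1 n) -> ex_series B1 ->
  (forall n x, seg a b x -> Rabs (f2 n x) <= B2 n) -> ex_series B2 ->
  forall x, seg a b x ->
    D_in (fun x => Series (fun n => f n x)) (fun x => Series (fun n => f1 n x)) (seg a b) x.
Proof.
intros d0 d1 b0 s0 b1 s1 b2 s2 x hx.
apply D_in_at. apply D_in_of_quadratic with (Series B2).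
intros s hs.
assert (e0 : forall y, seg a b y -> ex_series (fun n => f n y)).
{ intros y hy. apply ex_series_of_bound with B; auto. }
assert (e1 : ex_series (fun n => f1 n x)).
{ apply ex_series_of_bound with B1; auto. }
rewrite <- Series_scal_l, <- !Series_minus; auto.
2: { apply ex_series_minus with (a := fun n => f n s) (b := fun n => f n x); auto. }
2: { now apply @ex_series_scal. }
rewrite Rmult_comm, <- Series_scal_l.
apply Rabs_Series_le.
- intros n. rewrite (Rmult_comm ((s - x) ^ 2)). apply taylor_bound with a b (f2 n); auto.
- now apply @ex_series_scal.
Qed.

Lemma tower_Series (a b : R) (f : nat -> nat -> R -> R) (B : nat -> nat -> R) :
  (forall n, tower (seg a b) (f n)) ->
  (forall n m x, seg a b x -> Rabs (f n m x) <= B m n) ->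
  (forall m, ex_series (B m)) ->
  tower (seg a b) (fun m x => Series (fun n => f n m x)).
Proof.
intros Ht Hb Hs m x hx.
apply (D_in_Series a b (fun n => f n m) (fun n => f n (S m)) (fun n => f n (S (S m)))
  (B m) (B (S m)) (B (S (S m)))); auto; intros n z hz; now apply Ht.
Qed.

Lemma D_in_sum (D : R -> Prop) (f g : nat -> R -> R) (N : nat) (x : R) :
  (forall i, (i <= N)%nat -> D_in (f i) (g i) D x) ->
  D_in (fun t => sum_f_R0 (fun i => f i t) N) (fun t => sum_f_R0 (fun i => g i t) N) D x.
Proof.
induction N as [|N IH]; intros H; simpl.
- now apply H.
- apply Dadd; [apply IH; intros; apply H; lia | apply H; lia].
Qed.

Lemma tower_scal (D : R -> Prop) (c : R) (f : nat -> R -> R) :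
  tower D f -> tower D (fun m x => c * f m x).
Proof. intros H n x hx. apply Dmult_const. now apply H. Qed.

Lemma tower_add (D : R -> Prop) (f g : nat -> R -> R) :
  tower D f -> tower D g -> tower D (fun m x => f m x + g m x).
Proof. intros H H' n x hx. apply Dadd; auto. Qed.

Lemma tower_sub (D : R -> Prop) (f g : nat -> R -> R) :
  tower D f -> tower D g -> tower D (fun m x => f m x - g m x).
Proof. intros H H' n x hx. apply Dminus; auto. Qed.

Lemma tower_shift (D : R -> Prop) (f : nat -> R -> R) (k : nat) :
  tower D f -> tower D (fun m => f (m + k)%nat).
Proof. intros H n x hx. apply H; auto. Qed.

Lemma tower_sum (D : R -> Prop) (f : nat -> nat -> R -> R) (N : nat) :
  (forall j, (j <= N)%nat -> tower D (f j)) ->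
  tower D (fun m x => sum_f_R0 (fun j => f j m x) N).
Proof.
intros H n x hx. apply (D_in_sum D (fun i => f i n) (fun i => f i (S n))).
intros; now apply H.
Qed.

(** Time reversal exchanges the two ends of the interval; it is used to transport
constructions at [0] to [T]. *)
Lemma tower_reflect (T : R) (f : nat -> R -> R) :
  tower (seg 0 T) f -> tower (seg 0 T) (fun m t => (-1) ^ m * f m (T - t)).
Proof.
intros H m t ht.
assert (ht' : seg 0 T (T - t)) by (unfold seg in *; lra).
intros e he. destruct (H m _ ht' e he) as [d [hd Hd]].
exists d; split; auto. intros s [[hs hn] hsd]. simpl in *. unfold Rdist in *.
specialize (Hd (T - s)).
assert (h1 : D_x (seg 0 T) (T - t) (T - s)).
{ split; [unfold seg in *; lra | lra]. }
replace (T - s - (T - t)) with (- (s - t)) in Hd by ring.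
rewrite Rabs_Ropp in Hd. specialize (Hd (conj h1 hsd)).
replace (((-1) ^ m * f m (T - s) - (-1) ^ m * f m (T - t)) / (s - t) -
   -1 * (-1) ^ m * f (S m) (T - t))
 with ((-1) * (-1) ^ m * ((f m (T - s) - f m (T - t)) / - (s - t) - f (S m) (T - t)))
 by (field; lra).
rewrite !Rabs_mult, pow_1_abs, Rabs_m1, !Rmult_1_l. exact Hd.
Qed.

(** * Binomials, factorials and the Leibniz product *)

(** [binom p q] is the number of ways to choose [p] among [p + q] objects.  This
symmetric indexing makes Pascal's rule hold for all arguments, by computation. *)
Fixpoint binom (p : nat) : nat -> R :=
  match p with
  | O => fun _ => 1
  | S p' =>
      fix aux (q : nat) : R :=
        match q with O => 1 | S q' => binom p' (S q') + aux q' end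
  end.

Definition factR (n : nat) : R := INR (fact n).

Lemma factR_S (n : nat) : factR (S n) = INR (S n) * factR n.
Proof. unfold factR. now rewrite fact_simpl, mult_INR. Qed.

Lemma factR_ge1 (n : nat) : 1 <= factR n.
Proof. unfold factR. apply (le_INR 1). apply lt_O_fact. Qed.

Lemma factR_pos (n : nat) : 0 < factR n.
Proof. generalize (factR_ge1 n); lra. Qed.

Lemma factR_le (n m : nat) : (n <= m)%nat -> factR n <= factR m.
Proof. intros h. unfold factR. apply le_INR. now apply fact_le. Qed.

Lemma binom_0_r (p : nat) : binom p 0 = 1.
Proof. now destruct p. Qed.

Lemma binom_S (p q : nat) : binom (S p) (S q) = binom p (S q) + binom (S p) q.
Proof. reflexivity. Qed.

Lemma binom_ge1 (p : nat) : forall q, 1 <= binom p q.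
Proof.
induction p as [|p IH]; [intros q; simpl; lra|].
induction q as [|q IHq]; [simpl; lra|].
rewrite binom_S. specialize (IH (S q)). lra.
Qed.

Lemma binom_fact (p : nat) :
  forall q, binom p q * factR p * factR q = factR (p + q).
Proof.
induction p as [|p IH]; intros q.
- simpl. unfold factR at 1. simpl. ring.
- induction q as [|q IHq].
  + rewrite binom_0_r, Nat.add_0_r. unfold factR at 2. simpl. ring.
  + rewrite binom_S. replace (S p + S q)%nat with (S (S p + q)) by lia.
    rewrite (factR_S (S p + q)).
    replace (INR (S (S p + q))) with (INR (S p) + INR (S q))
      by (rewrite <- plus_INR; f_equal; lia).
    rewrite (Rmult_plus_distr_r (INR (S p))).
    replace (INR (S q) * factR (S p + q)) with (binom (S p) q * factR (S p) * factR (S q))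
      by (rewrite <- IHq, (factR_S q); ring).
    replace (S p + q)%nat with (p + S q)%nat by lia.
    rewrite <- IH, (factR_S p). ring.
Qed.

Lemma binom_mono_r (p q s : nat) : binom p q <= binom p (q + s).
Proof.
induction s as [|s IH].
- rewrite Nat.add_0_r; lra.
- replace (q + S s)%nat with (S (q + s)) by lia.
  destruct p as [|p]; [simpl; lra|].
  rewrite binom_S. generalize (binom_ge1 p (S (q + s))). lra.
Qed.

Lemma binom_mono_l (p q s : nat) : binom p q <= binom (p + s) q.
Proof.
induction s as [|s IH].
- rewrite Nat.add_0_r; lra.
- replace (p + S s)%nat with (S (p + s)) by lia.
  destruct q as [|q]; [rewrite !binom_0_r; lra|].
  rewrite binom_S. generalize (binom_ge1 (S (p + s)) q). lra.
Qed.

(** A choice in each of two disjoint sets is a choice in their union; by induction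
with Pascal's rule. *)
Lemma binom_supermult (p : nat) :
  forall q r s, binom p q * binom r s <= binom (p + r) (q + s).
Proof.
induction p as [|p IH]; intros q r s.
- simpl. rewrite Rmult_1_l, (Nat.add_comm q). apply binom_mono_r.
- induction q as [|q IHq].
  + rewrite binom_0_r, Rmult_1_l, (Nat.add_comm (S p)). apply binom_mono_l.
  + rewrite binom_S. simpl (S p + r)%nat. simpl (S q + s)%nat.
    rewrite binom_S, Rmult_plus_distr_r. apply Rplus_le_compat.
    * apply (IH (S q)).
    * apply IHq.
Qed.

Lemma binom_le_pow2 (p : nat) : forall q, binom p q <= 2 ^ (p + q).
Proof.
induction p as [|p IH]; intros q.
- apply (pow_R1_Rle 2 q). lra.
- induction q as [|q IHq].
  + rewrite binom_0_r. apply pow_R1_Rle. lra.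
  + rewrite binom_S. specialize (IH (S q)).
    replace (S p + q)%nat with (p + S q)%nat in IHq by lia.
    simpl (2 ^ (S p + S q)). lra.
Qed.

Lemma factR_plus_le (p q : nat) : factR (p + q) <= 2 ^ (p + q) * (factR p * factR q).
Proof.
rewrite <- binom_fact, Rmult_assoc. apply Rmult_le_compat_r; [|apply binom_le_pow2].
apply Rmult_le_pos; apply Rlt_le, factR_pos.
Qed.

Lemma factR_double_le (n : nat) : factR (2 * n) <= 4 ^ n * (factR n * factR n).
Proof.
assert (h := factR_plus_le n n). replace (n + n)%nat with (2 * n)%nat in h by lia.
rewrite pow_mult in h. replace (2 ^ 2) with 4 in h by ring. exact h.
Qed.

Lemma binom_double (i l : nat) : binom i l <= binom (2 * i) (2 * l).
Proof.
replace (2 * i)%nat with (i + i)%nat by lia.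
replace (2 * l)%nat with (l + l)%nat by lia.
apply Rle_trans with (2 := binom_supermult i l i l).
generalize (binom_ge1 i l). nra.
Qed.

Lemma binom_factR_double (i l : nat) :
  binom i l * (factR (2 * i) * factR (2 * l)) <= factR (2 * (i + l)).
Proof.
replace (2 * (i + l))%nat with (2 * i + 2 * l)%nat by lia.
rewrite <- (binom_fact (2 * i)), Rmult_assoc.
apply Rmult_le_compat_r; [|apply binom_double].
apply Rmult_le_pos; apply Rlt_le, factR_pos.
Qed.

(** Since a time derivative counts for two orders, the time binomial is first
replaced by [binom (2 * i) (2 * l)]; then [binom_supermult] merges the choices in space
and in time into one among all the orders.  This makes the majorant [(n + 2m)!] stable
under products. *)
Lemma binom_factR_mixed (j k i l : nat) :
  binom j k * binom i l * (factR (j + 2 * i) * factR (S k + 2 * l))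
  <= factR (j + k + 1 + 2 * (i + l)).
Proof.
replace (j + k + 1 + 2 * (i + l))%nat with ((j + 2 * i) + (S k + 2 * l))%nat by lia.
rewrite <- (binom_fact (j + 2 * i)), (Rmult_assoc (binom (j + 2 * i) (S k + 2 * l))).
apply Rmult_le_compat_r.
- apply Rmult_le_pos; apply Rlt_le, factR_pos.
- apply Rle_trans with (binom j (S k) * binom (2 * i) (2 * l)).
  + apply Rmult_le_compat; try (apply Rle_trans with 1; [lra|apply binom_ge1]).
    * replace (S k) with (k + 1)%nat by lia. apply binom_mono_r.
    * apply binom_double.
  + apply binom_supermult.
Qed.

Lemma Rabs_sum_le_const (f : nat -> R) (N : nat) (c : R) :
  (forall i, (i <= N)%nat -> Rabs (f i) <= c) ->
  Rabs (sum_f_R0 f N) <= INR (S N) * c.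
Proof.
intros h. apply Rle_trans with (1 := Rsum_abs f N).
rewrite Rmult_comm, <- sum_cte. now apply sum_Rle.
Qed.

(** The m-th derivative of a product, as a function of the derivatives of the
factors. *)
Definition leibniz (u v : nat -> R) (m : nat) : R :=
  sum_f_R0 (fun i => binom i (m - i) * u i * v (m - i)%nat) m.

(** Pascal's rule: differentiating a product of order [m] once more means
differentiating one factor or the other. *)
Lemma leibniz_S (u v : nat -> R) (m : nat) :
  leibniz u v (S m) = leibniz (fun i => u (S i)) v m + leibniz u (fun i => v (S i)) m.
Proof.
set (g := fun i => binom i (S m - i) * u i * v (S m - i)%nat).
set (g1 := fun i => binom i (m - i) * u (S i) * v (m - i)%nat).
set (g2 := fun i => binom i (m - i) * u i * v (S (m - i))).
assert (H : forall N, (N <= m)%nat ->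
  sum_f_R0 g N + g1 N = sum_f_R0 g1 N + sum_f_R0 g2 N).
{ induction N as [|N IH]; intros hN.
  - simpl. unfold g, g2. rewrite Nat.sub_0_r. simpl. rewrite Nat.sub_0_r. ring.
  - specialize (IH ltac:(lia)). rewrite !tech5.
    assert (E : g (S N) = g1 N + g2 (S N)).
    { unfold g, g1, g2. replace (S m - S N)%nat with (m - N)%nat by lia.
      replace (m - N)%nat with (S (m - S N)) by lia. rewrite binom_S. ring. }
    rewrite E. lra. }
unfold leibniz. fold g g1 g2. rewrite tech5, <- H by lia. f_equal.
unfold g, g1. rewrite !Nat.sub_diag, !binom_0_r. ring.
Qed.

Lemma leibniz_ext (u v u' v' : nat -> R) (m : nat) :
  (forall i, (i <= m)%nat -> u i = u' i) -> (forall i, (i <= m)%nat -> v i = v' i) ->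
  leibniz u v m = leibniz u' v' m.
Proof.
intros h h'. apply sum_eq. intros i hi. rewrite h, h'; auto; lia.
Qed.

Lemma tower_leibniz (D : R -> Prop) (f g : nat -> R -> R) :
  tower D f -> tower D g ->
  tower D (fun m t => leibniz (fun i => f i t) (fun i => g i t) m).
Proof.
intros hf hg m x hx. apply D_in_at. rewrite leibniz_S.
unfold leibniz. rewrite <- plus_sum.
apply D_in_congr with
  (f := fun t => sum_f_R0 (fun i => binom i (m - i) * (f i t * g (m - i)%nat t)) m)
  (l := sum_f_R0 (fun i => binom i (m - i) * (f (S i) x * g (m - i)%nat x +
            f i x * g (S (m - i)) x)) m); auto.
- intros s _. apply sum_eq. intros; ring.
- apply sum_eq. intros; ring.
- apply (D_in_sum D (fun i t => binom i (m - i) * (f i t * g (m - i)%nat t))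
   (fun i t => binom i (m - i) * (f (S i) t * g (m - i)%nat t + f i t * g (S (m - i)) t))).
  intros i _. apply Dmult_const. apply Dmult; auto.
Qed.

Lemma leibniz_at_flat (u v : nat -> R) (m : nat) :
  (forall i, v (S i) = 0) -> leibniz u v m = u m * v 0%nat.
Proof.
intros h. unfold leibniz. destruct m as [|m]; [simpl; ring|].
rewrite tech5, Nat.sub_diag, binom_0_r, (sum_eq _ (fun _ => 0)).
- rewrite sum_cte. ring.
- intros i hi. replace (S m - i)%nat with (S (m - i)) by lia. rewrite h. ring.
Qed.

Lemma sum_half_pow_le (m : nat) : sum_f_R0 (fun i => (/ 2) ^ (m - i)) m <= 2.
Proof.
assert (H : sum_f_R0 (fun i => (/ 2) ^ (m - i)) m = 2 - (/2) ^ m).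
{ induction m as [|m IH].
  - simpl. lra.
  - rewrite tech5, Nat.sub_diag.
    rewrite (sum_eq _ (fun i => (/ 2) ^ (m - i) * / 2)).
    + rewrite <- scal_sum, IH. simpl. lra.
    + intros i hi. replace (S m - i)%nat with (S (m - i)) by lia. simpl. ring. }
rewrite H. assert (0 <= (/2) ^ m) by (apply pow_le; lra). lra.
Qed.

(** One factor with a constant twice better makes the sum over the Leibniz
formula geometric, so that the product keeps the constant of the worse factor. *)
Lemma leibniz_gevrey2_bound (u v : nat -> R) (M N X : R) (m : nat) :
  0 <= M -> 0 <= N -> 0 <= X ->
  (forall i, Rabs (u i) <= M * factR (2 * i) * X ^ i) ->
  (forall i, Rabs (v i) <= N * factR (2 * i) * (X / 2) ^ i) ->
  Rabs (leibniz u v m) <= 2 * M * N * factR (2 * m) * X ^ m.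
Proof.
intros hM hN hX hu hv.
apply Rle_trans with (1 := Rsum_abs _ _).
apply Rle_trans with
  (sum_f_R0 (fun i => (/ 2) ^ (m - i) * (M * N * factR (2 * m) * X ^ m)) m).
- apply sum_Rle. intros i hi. rewrite !Rabs_mult.
  rewrite (Rabs_pos_eq (binom i (m - i)))
    by (apply Rle_trans with 1; [lra|apply binom_ge1]).
  assert (hB := binom_ge1 i (m - i)).
  apply Rle_trans with (binom i (m - i) * (M * factR (2 * i) * X ^ i) *
     (N * factR (2 * (m - i)) * (X / 2) ^ (m - i))).
  + apply Rmult_le_compat; auto using Rabs_pos.
    * apply Rmult_le_pos; [lra|apply Rabs_pos].
    * apply Rmult_le_compat_l; [lra|auto].
  + assert (hb := binom_factR_double i (m - i)).
    replace (i + (m - i))%nat with m in hb by lia.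
    assert (hp : X ^ m = X ^ i * X ^ (m - i)) by (rewrite <- pow_add; f_equal; lia).
    rewrite hp. unfold Rdiv. rewrite Rpow_mult_distr.
    assert (h1 : 0 <= M * N * (X ^ i * X ^ (m - i)) * (/2) ^ (m - i)).
    { repeat apply Rmult_le_pos; auto; apply pow_le; lra. }
    apply Rmult_le_compat_r with (1 := h1) in hb.
    set (w := (/ 2) ^ (m - i)) in *. clearbody w.
    eapply Rle_trans; [|eapply Rle_trans; [exact hb|]]; right; ring.
- rewrite <- scal_sum.
  assert (h0 : 0 <= M * N * factR (2 * m) * X ^ m).
  { repeat apply Rmult_le_pos; auto; [apply Rlt_le, factR_pos | now apply pow_le]. }
  generalize (sum_half_pow_le m). nra.
Qed.

(** The derivative of order [n] in [x] and [m] in [t] of [2 y (dy/dx)], when [u n m]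
are the derivatives of [y]. *)
Definition conv (u : nat -> nat -> R) (n m : nat) : R :=
  2 * sum_f_R0 (fun j => binom j (n - j) * leibniz (u j) (u (S (n - j))) m) n.

Lemma conv_ext (u v : nat -> nat -> R) (n m : nat) :
  (forall j i, (j <= S n)%nat -> (i <= m)%nat -> u j i = v j i) ->
  conv u n m = conv v n m.
Proof.
intros h. unfold conv. f_equal. apply sum_eq. intros j hj. f_equal.
apply leibniz_ext; intros; apply h; lia.
Qed.

(** Of the three orders by which [n + 4 + 2m] exceeds [n + 1 + 2m], two pay for the
number [(n + 1)(m + 1)] of terms in the sum. *)
Lemma conv_bound (u : nat -> nat -> R) (n m : nat) (e X Z : R) :
  0 <= e -> 0 < X -> 0 < Z ->
  (forall j i, (j <= S n)%nat -> (i <= m)%nat ->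
     Rabs (u j i) <= e * factR (j + 2 * i) / (X ^ j * Z ^ i)) ->
  Rabs (conv u n m) <= 2 * e ^ 2 * factR (n + 4 + 2 * m) / (X ^ (S n) * Z ^ m).
Proof.
intros he hX hZ hu.
set (c := e ^ 2 * factR (n + 1 + 2 * m) / (X ^ (S n) * Z ^ m)).
assert (hXp : forall k, 0 < X ^ k) by (intro; now apply pow_lt).
assert (hZp : forall k, 0 < Z ^ k) by (intro; now apply pow_lt).
assert (Hs : Rabs (sum_f_R0 (fun j => binom j (n - j) * leibniz (u j) (u (S (n - j))) m) n)
   <= INR (S n) * (INR (S m) * c)).
{ apply Rabs_sum_le_const. intros j hj. unfold leibniz. rewrite scal_sum.
  apply Rabs_sum_le_const. intros i hi.
  assert (hB := binom_ge1 i (m - i)). assert (hB' := binom_ge1 j (n - j)).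
  rewrite !Rabs_mult, (Rabs_pos_eq (binom i (m - i))), (Rabs_pos_eq (binom j (n - j)))
    by lra.
  apply Rle_trans with (binom i (m - i) * (e * factR (j + 2 * i) / (X ^ j * Z ^ i)) *
     (e * factR (S (n - j) + 2 * (m - i)) / (X ^ S (n - j) * Z ^ (m - i))) * binom j (n - j)).
  - apply Rmult_le_compat_r; [lra|]. apply Rmult_le_compat; auto using Rabs_pos.
    + apply Rmult_le_pos; [lra|apply Rabs_pos].
    + apply Rmult_le_compat_l; [lra|auto].
    + apply hu; lia.
  - assert (hb := binom_factR_mixed j (n - j) i (m - i)).
    replace (j + (n - j) + 1 + 2 * (i + (m - i)))%nat with (n + 1 + 2 * m)%nat in hb by lia.
    assert (hx : X ^ S n = X ^ j * X ^ S (n - j)) by (rewrite <- pow_add; f_equal; lia).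
    assert (hz : Z ^ m = Z ^ i * Z ^ (m - i)) by (rewrite <- pow_add; f_equal; lia).
    unfold c. rewrite hx, hz.
    assert (h1 : 0 <= e ^ 2 / (X ^ j * X ^ S (n - j) * (Z ^ i * Z ^ (m - i)))).
    { apply Rmult_le_pos; [apply pow2_ge_0|]. apply Rlt_le, Rinv_0_lt_compat.
      repeat apply Rmult_lt_0_compat; auto. }
    apply Rmult_le_compat_r with (1 := h1) in hb.
    generalize (hXp j), (hXp (S (n - j))), (hZp i), (hZp (m - i)%nat). intros.
    eapply Rle_trans; [|eapply Rle_trans; [exact hb|]]; right; field; repeat split; lra. }
unfold conv. rewrite Rabs_mult, (Rabs_pos_eq 2) by lra.
apply Rle_trans with (2 * (INR (S n) * (INR (S m) * c))); [lra|].
assert (hf : INR (S n) * INR (S m) * factR (n + 1 + 2 * m) <= factR (n + 4 + 2 * m)).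
{ replace (n + 4 + 2 * m)%nat with (S (S (S (n + 1 + 2 * m)))) by lia.
  rewrite !factR_S, <- !Rmult_assoc. apply Rmult_le_compat_r; [apply Rlt_le, factR_pos|].
  apply Rle_trans with (INR (S (S (S (n + 1 + 2 * m)))) * INR (S (S (n + 1 + 2 * m))) * 1).
  - rewrite Rmult_1_r. apply Rmult_le_compat; try apply pos_INR; apply le_INR; lia.
  - apply Rmult_le_compat_l; [apply Rmult_le_pos; apply pos_INR|].
    apply (le_INR 1). lia. }
assert (h1 : 0 <= 2 * e ^ 2 / (X ^ S n * Z ^ m)).
{ apply Rmult_le_pos; [generalize (pow2_ge_0 e); lra|]. apply Rlt_le, Rinv_0_lt_compat.
  apply Rmult_lt_0_compat; auto. }
apply Rmult_le_compat_r with (1 := h1) in hf. unfold c.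
generalize (hXp (S n)), (hZp m). intros.
eapply Rle_trans; [|eapply Rle_trans; [exact hf|]]; right; field; repeat split; lra.
Qed.

(** Partial sums of the expansion of [(1 - q)^(-k-1)].  By Pascal's rule the sums
for [k + 1] are at most those for [k] plus [q] times themselves. *)
Lemma sum_binom_pow_le (q : R) (k : nat) : 0 <= q < 1 ->
  forall N, sum_f_R0 (fun n => binom n k * q ^ n) N <= (/ (1 - q)) ^ (S k).
Proof.
intros hq.
assert (hL : 0 < / (1 - q)) by (apply Rinv_0_lt_compat; lra).
assert (hL1 : 1 + q * / (1 - q) = / (1 - q)) by (field; lra).
induction k as [|k IH].
- intros N. rewrite (sum_eq _ (fun n => q ^ n)).
  2: { intros; rewrite binom_0_r; ring. }
  rewrite tech3 by lra. unfold Rdiv. simpl (_ ^ 1). rewrite Rmult_1_r.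
  rewrite <- (Rmult_1_l (/ (1 - q))) at 2. apply Rmult_le_compat_r; [lra|].
  assert (0 <= q ^ S N) by (apply pow_le; lra). lra.
- assert (E : forall N, sum_f_R0 (fun n => binom n (S k) * q ^ n) (S N) =
    sum_f_R0 (fun n => binom n k * q ^ n) (S N) +
    q * sum_f_R0 (fun n => binom n (S k) * q ^ n) N).
  { induction N as [|N IHN].
    - cbn [sum_f_R0]. rewrite binom_S. simpl (binom 0 _). ring.
    - assert (E1 := tech5 (fun n => binom n (S k) * q ^ n) N). cbv beta in E1.
      rewrite 2!(tech5 _ (S N)). rewrite E1 in *. rewrite (binom_S (S N)).
      simpl (q ^ S (S N)). simpl (q ^ S N) in *. lra. }
  assert (hp : 0 <= (/ (1 - q)) ^ S k) by (apply pow_le; lra).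
  assert (hT : (/ (1 - q)) ^ S (S k) = (/ (1 - q)) ^ S k + q * (/ (1 - q)) ^ S (S k)).
  { change ((/ (1 - q)) ^ S (S k)) with (/ (1 - q) * (/ (1 - q)) ^ S k).
    rewrite <- hL1 at 1. ring. }
  assert (hp' : 0 <= (/ (1 - q)) ^ S (S k)) by (apply pow_le; lra).
  induction N as [|N IHN].
  + specialize (IH 0%nat). cbn [sum_f_R0 binom pow] in IH |- *. simpl (q ^ 0) in *.
    rewrite Rmult_1_l in *. simpl in IH, hT, hp' |- *. nra.
  + rewrite E, hT. apply Rplus_le_compat; [apply IH|].
    apply Rmult_le_compat_l; lra.
Qed.

Lemma series_of_bounded_sums (u : nat -> R) (M : R) :
  (forall n, 0 <= u n) -> (forall N, sum_f_R0 u N <= M) ->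
  ex_series u /\ Series u <= M.
Proof.
intros hu hM.
assert (hl : ex_finite_lim_seq (sum_n u)).
{ apply ex_finite_lim_seq_incr with M.
  - intros n. rewrite sum_Sn. unfold plus; simpl. generalize (hu (S n)); lra.
  - intros n. rewrite sum_n_Reals. apply hM. }
destruct hl as [l hl].
assert (hs : is_series u l) by exact hl.
split; [now exists l|]. rewrite (is_series_unique _ _ hs).
apply (is_lim_seq_le (sum_n u) (fun _ => M) l M); auto.
- intros n. rewrite sum_n_Reals. apply hM.
- apply is_lim_seq_const.
Qed.

Lemma series_binom_pow (q : R) (k : nat) : 0 <= q < 1 ->
  ex_series (fun n => binom n k * q ^ n) /\
  Series (fun n => binom n k * q ^ n) <= (/ (1 - q)) ^ (S k).
Proof.
intros hq. apply series_of_bounded_sums.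
- intros n. apply Rmult_le_pos; [|apply pow_le; lra].
  apply Rle_trans with 1; [lra|apply binom_ge1].
- now apply sum_binom_pow_le.
Qed.

(** This absorbs polynomial factors in [n] into a slightly larger geometric rate. *)
Lemma binom_pow_le (q : R) (k n : nat) : 0 <= q < 1 ->
  binom n k * q ^ n <= (/ (1 - q)) ^ (S k).
Proof.
intros hq.
assert (hp : forall n, 0 <= binom n k * q ^ n).
{ intros i. apply Rmult_le_pos; [|apply pow_le; lra].
  apply Rle_trans with 1; [lra|apply binom_ge1]. }
apply Rle_trans with (2 := sum_binom_pow_le q k hq n).
destruct n as [|n]; [simpl; lra|]. rewrite tech5.
assert (0 <= sum_f_R0 (fun n => binom n k * q ^ n) n) by (apply cond_pos_sum; auto).
lra.
Qed.

(** * Borel's lemma for jets of Gevrey order 2 *)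

(** [flat_exp b m a] is the m-th derivative of [t^(-a) exp(-b/t)], continued by [0]
for [t <= 0].  The recursion is the derivative of this family in terms of itself. *)
Fixpoint flat_exp (b : R) (m : nat) : nat -> R -> R :=
  match m with
  | O => fun a t => if Rle_dec t 0 then 0 else exp (- (b / t)) / t ^ a
  | S m' => fun a t => b * flat_exp b m' (S (S a)) t - INR a * flat_exp b m' (S a) t
  end.

Lemma flat_exp_S (b : R) (m a : nat) (t : R) :
  flat_exp b (S m) a t = b * flat_exp b m (S (S a)) t - INR a * flat_exp b m (S a) t.
Proof. reflexivity. Qed.

Lemma flat_exp_nonpos (b : R) (m : nat) : forall a t, t <= 0 -> flat_exp b m a t = 0.
Proof.
induction m as [|m IH]; intros a t ht.
- simpl. destruct Rle_dec; [reflexivity|lra].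
- rewrite flat_exp_S, !IH by auto. ring.
Qed.

Lemma flat_exp_0_pos (b : R) (a : nat) (t : R) :
  0 < t -> flat_exp b 0 a t = exp (- (b / t)) / t ^ a.
Proof. intros ht. simpl. destruct Rle_dec; [lra|reflexivity]. Qed.

Lemma flat_exp_0_mul (b : R) (a : nat) (t : R) : t * flat_exp b 0 (S a) t = flat_exp b 0 a t.
Proof.
simpl. destruct Rle_dec; [ring|]. field. split; [apply pow_nonzero|]; lra.
Qed.

Lemma pow_div_factR_le_exp (x : R) (a : nat) : 0 <= x -> x ^ a / factR a <= exp x.
Proof.
intros hx. apply Rle_trans with (2 := exp_ge_taylor x a hx).
destruct a as [|a]; [simpl; unfold factR; simpl; lra|].
rewrite tech5. unfold factR.
assert (0 <= sum_f_R0 (fun k => x ^ k / INR (fact k)) a); [|lra].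
apply cond_pos_sum. intros n. apply Rmult_le_pos; [now apply pow_le|].
apply Rlt_le, Rinv_0_lt_compat, (factR_pos n).
Qed.

Lemma flat_exp_0_bound (b : R) (a : nat) (t : R) :
  0 < b -> 0 <= flat_exp b 0 a t <= factR a / b ^ a.
Proof.
intros hb.
assert (hba : 0 < b ^ a) by now apply pow_lt.
assert (hf := factR_pos a).
destruct (Rle_dec t 0) as [h|h].
- rewrite flat_exp_nonpos by auto. split; [lra|]. apply Rlt_le, Rdiv_lt_0_compat; lra.
- rewrite flat_exp_0_pos by lra. rewrite exp_Ropp.
  assert (hta : 0 < t ^ a) by (apply pow_lt; lra).
  assert (he := exp_pos (b / t)).
  assert (hx : 0 <= b / t) by (apply Rlt_le, Rdiv_lt_0_compat; lra).
  assert (hp := pow_div_factR_le_exp (b / t) a hx).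
  split.
  + apply Rlt_le, Rdiv_lt_0_compat; auto. now apply Rinv_0_lt_compat.
  + unfold Rdiv in hp at 1 2. rewrite Rpow_mult_distr, pow_inv in hp.
    assert (h1 : 0 <= factR a / b ^ a * / exp (b / t)).
    { apply Rmult_le_pos; apply Rlt_le; [apply Rdiv_lt_0_compat|apply Rinv_0_lt_compat]; auto. }
    apply Rmult_le_compat_r with (1 := h1) in hp.
    eapply Rle_trans; [|eapply Rle_trans; [exact hp|]]; right; field; repeat split; lra.
Qed.

(** The Gevrey estimate of order 2 for [exp(-b/t)], with a constant proportional
to [b].  The exponent [a] is what makes an induction on [m] possible, without any use of
complex variables. *)
Lemma flat_exp_bound (b : R) (m : nat) : 0 < b -> forall a t,
  Rabs (flat_exp b m a t) <= 2 ^ m * factR (a + 2 * m) / b ^ (a + m).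
Proof.
intros hb. induction m as [|m IH]; intros a t.
- rewrite Nat.mul_0_r, !Nat.add_0_r, Rmult_1_l.
  destruct (flat_exp_0_bound b a t hb). now rewrite Rabs_pos_eq.
- rewrite flat_exp_S. unfold Rminus.
  apply Rle_trans with (1 := Rabs_triang _ _).
  rewrite Rabs_Ropp, !Rabs_mult, (Rabs_pos_eq b), (Rabs_pos_eq (INR a))
    by (apply pos_INR || lra).
  assert (h1 := Rmult_le_compat_l b _ _ ltac:(lra) (IH (S (S a)) t)).
  assert (h2 := Rmult_le_compat_l (INR a) _ _ (pos_INR a) (IH (S a) t)).
  apply Rle_trans with (1 := Rplus_le_compat _ _ _ _ h1 h2).
  replace (S (S a) + 2 * m)%nat with (S (S a + 2 * m)) by lia.
  replace (a + 2 * S m)%nat with (S (S a + 2 * m)) by lia.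
  rewrite factR_S. set (k := (S a + 2 * m)%nat).
  assert (hk : INR a <= INR (S k)) by (apply le_INR; unfold k; lia).
  replace (S (S a) + m)%nat with (S (S a + m)) by lia.
  replace (a + S m)%nat with (S a + m)%nat by lia.
  assert (hp : 0 < b ^ (S a + m)) by now apply pow_lt.
  change (b ^ S (S a + m)) with (b * b ^ (S a + m)).
  set (w := b ^ (S a + m)) in *. clearbody w.
  assert (hc : 0 <= 2 ^ m * factR k / w).
  { apply Rmult_le_pos; [|now apply Rlt_le, Rinv_0_lt_compat].
    apply Rmult_le_pos; [apply pow_le; lra|apply Rlt_le, factR_pos]. }
  apply Rmult_le_compat_r with (1 := hc) in hk. simpl (2 ^ S m).
  apply Rle_trans with (INR (S k) * (2 ^ m * factR k / w) + INR a * (2 ^ m * factR k / w)).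
  + right; field; lra.
  + apply Rle_trans with (2 * (INR (S k) * (2 ^ m * factR k / w))); [lra|].
    right; field; lra.
Qed.

Lemma is_derive_of_quadratic (f : R -> R) (x l M : R) :
  (forall s, Rabs (f s - f x - (s - x) * l) <= M * (s - x) ^ 2) ->
  is_derive f x l.
Proof.
intros H. apply (is_derive_of_D_in (x - 1) (x + 1)); [lra|].
apply D_in_of_quadratic with M. auto.
Qed.

(** At [t = 0] each negative power can be traded for a factor [t]:
the function is [t^2] times a bounded one. *)
Lemma is_derive_flat_exp_0 (b : R) (a : nat) (t : R) :
  0 < b -> is_derive (flat_exp b 0 a) t (flat_exp b 1 a t).
Proof.
intros hb. destruct (Rtotal_order t 0) as [h|[->|h]].
- rewrite flat_exp_nonpos by lra.
  apply is_derive_ext_loc with (fun _ => 0).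
  + exists (mkposreal (- t) ltac:(lra)). intros z hz.
    assert (h5 := Rabs_def2 _ _ hz). unfold minus, plus, opp in h5; simpl in h5.
    rewrite flat_exp_nonpos; lra.
  + apply @is_derive_const.
- rewrite flat_exp_nonpos by lra.
  apply is_derive_of_quadratic with (factR (S (S a)) / b ^ (S (S a))).
  intros s. rewrite (flat_exp_nonpos b 0 a 0) by lra.
  rewrite <- flat_exp_0_mul, <- flat_exp_0_mul.
  replace (s * (s * flat_exp b 0 (S (S a)) s) - 0 - (s - 0) * 0)
    with (flat_exp b 0 (S (S a)) s * (s - 0) ^ 2) by ring.
  destruct (flat_exp_0_bound b (S (S a)) s hb) as [h1 h2].
  assert (h3 := pow2_ge_0 (s - 0)).
  rewrite Rabs_pos_eq; [|now apply Rmult_le_pos].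
  now apply Rmult_le_compat_r.
- apply is_derive_ext_loc with (fun t => exp (- (b / t)) / t ^ a).
  + exists (mkposreal t h). intros z hz.
    assert (h5 := Rabs_def2 _ _ hz). unfold minus, plus, opp in h5; simpl in h5.
    rewrite flat_exp_0_pos; [reflexivity|lra].
  + assert (hta : t ^ a <> 0) by (apply pow_nonzero; lra).
    auto_derive; [split; [lra|auto]|].
    rewrite flat_exp_S, !flat_exp_0_pos by lra. unfold Rdiv.
    destruct a as [|a].
    * simpl. field. lra.
    * simpl pred. change (t ^ S (S (S a))) with (t * (t * (t * t ^ a))).
      change (t ^ S (S a)) with (t * (t * t ^ a)). change (t ^ S a) with (t * t ^ a).
      field. split; [apply pow_nonzero|]; lra.
Qed.

Lemma is_derive_flat_exp (b : R) (m : nat) : 0 < b -> forall a t,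
  is_derive (flat_exp b m a) t (flat_exp b (S m) a t).
Proof.
intros hb. induction m as [|m IH]; intros a t.
- now apply is_derive_flat_exp_0.
- rewrite flat_exp_S. apply is_derive_ext with
   (fun t => minus (b * flat_exp b m (S (S a)) t) (INR a * flat_exp b m (S a) t)).
  { intros s. reflexivity. }
  apply (@is_derive_minus R_AbsRing R_NormedModule).
  + apply is_derive_scal. apply IH.
  + apply is_derive_scal. apply IH.
Qed.

(** The function [t^n (1 - exp(-b/t) sum_(k <= n) (b/t)^k / k!)], equal for
[t > 0] to the Laplace integral of [x^n/n! exp(-x/t) / t] truncated to [0 <= x <= b].  It
has the same jet at [0] as [t^n], but it stays below [b^n / n!] for all [t >= 0]. *)
Fixpoint cut_monomial0 (b : R) (n : nat) (t : R) : R :=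
  match n with
  | O => 1 - flat_exp b 0 0 t
  | S k => t * cut_monomial0 b k t - b ^ S k / factR (S k) * flat_exp b 0 0 t
  end.

(** [cut_monomial b m n] is the m-th derivative of [cut_monomial0 b n]. *)
Fixpoint cut_monomial (b : R) (m : nat) : nat -> R -> R :=
  match m with
  | O => cut_monomial0 b
  | S m' => fun n t => INR n * cut_monomial b m' (pred n) t
              - b ^ n / factR n * (INR n * flat_exp b m' 1 t + b * flat_exp b m' 2 t)
  end.

Lemma cut_monomial_S (b : R) (m n : nat) (t : R) :
  cut_monomial b (S m) n t = INR n * cut_monomial b m (pred n) t
              - b ^ n / factR n * (INR n * flat_exp b m 1 t + b * flat_exp b m 2 t).
Proof. reflexivity. Qed.

Lemma cut_monomial0_S (b : R) (n : nat) (t : R) :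
  cut_monomial0 b (S n) t = t * cut_monomial0 b n t - b ^ S n / factR (S n) * flat_exp b 0 0 t.
Proof. reflexivity. Qed.

Lemma factR_0 : factR 0 = 1. Proof. reflexivity. Qed.

Lemma is_derive_cut_monomial0 (b : R) (n : nat) (t : R) : 0 < b ->
  is_derive (cut_monomial0 b n) t (cut_monomial b 1 n t).
Proof.
intros hb. induction n as [|n IH].
- apply is_derive_ext with (fun t => minus 1 (flat_exp b 0 0 t)); [reflexivity|].
  evar_last. { apply (@is_derive_minus R_AbsRing R_NormedModule).
   - apply @is_derive_const.
   - now apply is_derive_flat_exp. }
  rewrite flat_exp_S, cut_monomial_S, factR_0. unfold minus, plus, opp, zero; simpl. field.
- apply is_derive_ext with
    (fun t => minus (t * cut_monomial0 b n t) (b ^ S n / factR (S n) * flat_exp b 0 0 t));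
    [reflexivity|].
  evar_last. { apply (@is_derive_minus R_AbsRing R_NormedModule).
   - apply (is_derive_mult (fun t : R => t)); [apply @is_derive_id|exact IH|].
     intros; apply Rmult_comm.
   - apply is_derive_scal. now apply is_derive_flat_exp. }
  rewrite flat_exp_S, !cut_monomial_S.
  assert (h0 := flat_exp_0_mul b 0 t). assert (h1 := flat_exp_0_mul b 1 t).
  assert (hf := factR_pos n). simpl (pred (S n)).
  change (cut_monomial b 0) with (cut_monomial0 b).
  rewrite factR_S. simpl (b ^ S n).
  assert (hn : INR (S n) <> 0) by (apply not_0_INR; lia).
  assert (E : t * (INR n * cut_monomial0 b (pred n) t) =
     INR n * cut_monomial0 b n t + INR n * (b ^ n / factR n) * flat_exp b 0 0 t).
  { destruct n as [|n]; [simpl; ring|].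
    simpl (pred _). rewrite cut_monomial0_S. ring. }
  change (1 * cut_monomial0 b n t +
     t * (INR n * cut_monomial0 b (pred n) t -
      b ^ n / factR n * (INR n * flat_exp b 0 1 t + b * flat_exp b 0 2 t)) -
     b * b ^ n / (INR (S n) * factR n) * (b * flat_exp b 0 2 t - 0 * flat_exp b 0 1 t) =
     INR (S n) * cut_monomial0 b n t - b * b ^ n / (INR (S n) * factR n)
       * (INR (S n) * flat_exp b 0 1 t + b * flat_exp b 0 2 t)).
  rewrite Rmult_minus_distr_l, E, <- h0, <- h1. rewrite S_INR in *.
  field. lra.
Qed.

Lemma is_derive_cut_monomial (b : R) (m : nat) : 0 < b -> forall n t,
  is_derive (cut_monomial b m n) t (cut_monomial b (S m) n t).
Proof.
intros hb. induction m as [|m IH]; intros n t.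
- now apply is_derive_cut_monomial0.
- rewrite (cut_monomial_S b (S m)). apply is_derive_ext with
   (fun t => minus (INR n * cut_monomial b m (pred n) t)
      (b ^ n / factR n * (plus (INR n * flat_exp b m 1 t) (b * flat_exp b m 2 t)))).
  { intros s. reflexivity. }
  apply (@is_derive_minus R_AbsRing R_NormedModule).
  + apply is_derive_scal. apply IH.
  + apply is_derive_scal. apply (@is_derive_plus R_AbsRing R_NormedModule);
    apply is_derive_scal; now apply is_derive_flat_exp.
Qed.

Lemma exp_tail_bound (x : R) (n : nat) : 0 <= x ->
  exp x - sum_f_R0 (fun k => x ^ k / factR k) n <= x ^ n / factR n * exp x.
Proof.
intros hx.
assert (hterm : forall k, 0 <= x ^ k / factR k).
{ intros k. apply Rmult_le_pos; [now apply pow_le|].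
  apply Rlt_le, Rinv_0_lt_compat, factR_pos. }
assert (He : is_series (fun k => x ^ k / factR k) (exp x)).
{ generalize (is_exp_Reals x). unfold is_pseries. apply is_series_ext.
  intros k. rewrite pow_n_pow. unfold scal; simpl; unfold mult; simpl. unfold factR, Rdiv. ring. }
assert (He' : ex_series (fun k => x ^ k / factR k)) by now exists (exp x).
destruct n as [|n].
- cbn [sum_f_R0 pow]. rewrite factR_0. lra.
- assert (E := Series_incr_n _ (S n) ltac:(lia) He'). simpl (pred _) in E.
  rewrite (is_series_unique _ _ He) in E. rewrite tech5.
  assert (hs : Series (fun k => x ^ (S n + k) / factR (S n + k)) <=
     Series (fun k => x ^ S n / factR (S n) * (x ^ k / factR k))).
  { apply Series_le.
    - intros k. split; [apply hterm|].
      rewrite pow_add.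
      assert (hb := binom_fact (S n) k). assert (hb1 := binom_ge1 (S n) k).
      assert (hf := factR_pos (S n)). assert (hf' := factR_pos k).
      assert (hx1 : 0 <= x ^ S n * x ^ k) by (apply Rmult_le_pos; now apply pow_le).
      rewrite <- hb. apply Rle_trans with (x ^ S n * x ^ k * / (1 * factR (S n) * factR k)).
      + apply Rmult_le_compat_l; auto. apply Rinv_le_contravar.
        * rewrite Rmult_1_l. now apply Rmult_lt_0_compat.
        * apply Rmult_le_compat_r; [lra|]. apply Rmult_le_compat_r; lra.
      + right. field. lra.
    - now apply @ex_series_scal. }
  rewrite Series_scal_l, (is_series_unique _ _ He) in hs.
  generalize (hterm (S n)). lra.
Qed.

Lemma cut_monomial0_closed_form (b : R) (n : nat) (t : R) : 0 < t ->
  cut_monomial0 b n t = t ^ n * exp (- (b / t)) *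
    (exp (b / t) - sum_f_R0 (fun k => (b / t) ^ k / factR k) n).
Proof.
intros ht.
assert (he : exp (- (b / t)) * exp (b / t) = 1).
{ rewrite <- exp_plus, Rplus_opp_l. apply exp_0. }
induction n as [|n IH].
- simpl. destruct Rle_dec; [lra|]. rewrite factR_0. unfold Rdiv at 1. rewrite Rinv_1.
  rewrite <- he at 1. ring_simplify. rewrite he. field; lra.
- rewrite cut_monomial0_S, IH, tech5, flat_exp_0_pos by auto.
  replace ((b / t) ^ S n) with (b ^ S n / t ^ S n)
    by (unfold Rdiv; now rewrite Rpow_mult_distr, pow_inv).
  assert (h1 := pow_nonzero t n ltac:(lra)). assert (h2 := factR_pos (S n)).
  simpl (t ^ S n). simpl (t ^ 0). field. repeat split; auto; lra.
Qed.

(** The bound [exp_tail_bound], one power of [x = b/t] below the order of the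
tail, exactly compensates the growth of [t^n]. *)
Lemma cut_monomial0_bound (b : R) (n : nat) (t : R) : 0 < b -> 0 <= t ->
  Rabs (cut_monomial0 b n t) <= b ^ n / factR n.
Proof.
intros hb ht.
assert (hp : 0 < b ^ n / factR n).
{ apply Rdiv_lt_0_compat; [now apply pow_lt|apply factR_pos]. }
destruct ht as [ht|<-].
- rewrite cut_monomial0_closed_form by auto.
  assert (hx : 0 <= b / t) by (apply Rlt_le, Rdiv_lt_0_compat; lra).
  assert (h1 := exp_tail_bound (b / t) n hx).
  assert (h2 := exp_ge_taylor (b / t) n hx).
  change (fun k => (b / t) ^ k / INR (fact k)) with (fun k => (b / t) ^ k / factR k) in h2.
  assert (h3 : 0 < t ^ n * exp (- (b / t))).
  { apply Rmult_lt_0_compat; [now apply pow_lt|apply exp_pos]. }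
  rewrite Rabs_pos_eq; [|apply Rmult_le_pos; lra].
  apply Rle_trans with (1 := Rmult_le_compat_l _ _ _ (Rlt_le _ _ h3) h1).
  assert (he : exp (- (b / t)) * exp (b / t) = 1).
  { rewrite <- exp_plus, Rplus_opp_l. apply exp_0. }
  replace (t ^ n * exp (- (b / t)) * ((b / t) ^ n / factR n * exp (b / t)))
    with (t ^ n * (b / t) ^ n / factR n * (exp (- (b / t)) * exp (b / t)))
    by (unfold Rdiv; ring).
  rewrite he, Rmult_1_r, <- Rpow_mult_distr. right.
  replace (t * (b / t)) with b by (field; lra). reflexivity.
- assert (hz : cut_monomial0 b n 0 = 0 \/ (n = 0%nat /\ cut_monomial0 b n 0 = 1)).
  { destruct n as [|n]; [right; split; auto|left].
    - simpl. destruct Rle_dec; lra.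
    - rewrite cut_monomial0_S, flat_exp_nonpos by lra. ring. }
  destruct hz as [->|[-> ->]].
  + rewrite Rabs_R0. lra.
  + rewrite Rabs_R1, factR_0. simpl. lra.
Qed.

(** The right-hand side is chosen stable under the recursion: with [W] the next
factorial, each of the two contributions to the derivative is at most half of the new
bound, because [n^3 (n + 2m - 1)!] and [n! (2m + 1)! (n + 2m + 2)] are both at most
[W = (n + 2m + 2)!]. *)
Lemma cut_monomial_bound (b : R) (m : nat) : 0 < b -> forall n t, 0 <= t ->
  Rabs (cut_monomial b m n t) <= 2 ^ m * b ^ n / b ^ m * factR (n + 2 * m) / (factR n * factR n).
Proof.
intros hb. induction m as [|m IH]; intros n t ht.
- apply Rle_trans with (1 := cut_monomial0_bound b n t hb ht).
  rewrite Nat.mul_0_r, Nat.add_0_r. simpl. assert (h := factR_pos n).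
  right; field. lra.
- rewrite cut_monomial_S. unfold Rminus. apply Rle_trans with (1 := Rabs_triang _ _).
  assert (hf := factR_pos n). assert (hbn := pow_lt b n hb).
  assert (hbm := pow_lt b m hb). assert (h2m := pow_lt 2 m ltac:(lra)).
  set (W := factR (n + 2 * m + 2)).
  set (c := 2 ^ m * b ^ n / (b * b ^ m) / (factR n * factR n)).
  assert (hW : 0 < W) by apply factR_pos.
  assert (hc : 0 < c).
  { unfold c. repeat first [apply Rdiv_lt_0_compat | apply Rmult_lt_0_compat]; auto. }
  assert (H1 : Rabs (INR n * cut_monomial b m (pred n) t) <= c * W).
  { destruct n as [|n]; [simpl (INR 0); rewrite Rmult_0_l, Rabs_R0;
      apply Rlt_le; now apply Rmult_lt_0_compat|].
    rewrite Rabs_mult, (Rabs_pos_eq (INR (S n))) by apply pos_INR. simpl (pred _).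
    apply Rle_trans with (1 := Rmult_le_compat_l _ _ _ (pos_INR (S n)) (IH n t ht)).
    assert (hk : INR (S n) * (INR (S n) * INR (S n)) * factR (n + 2 * m) <= W).
    { unfold W. replace (S n + 2 * m + 2)%nat with (S (S (S (n + 2 * m)))) by lia.
      rewrite !factR_S, <- !Rmult_assoc.
      apply Rmult_le_compat_r; [apply Rlt_le, factR_pos|].
      repeat apply Rmult_le_compat; try apply Rmult_le_pos; try apply pos_INR;
       apply le_INR; lia. }
    unfold c. rewrite factR_S in *. simpl (b ^ S n) in *.
    assert (hn : 0 < INR (S n)) by (apply lt_0_INR; lia).
    assert (hfn := factR_pos n). assert (hbn' := pow_lt b n hb).
    set (d := 2 ^ m * b ^ n / b ^ m / (INR (S n) * factR n * (INR (S n) * factR n))).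
    assert (hd : 0 <= d).
    { unfold d. apply Rlt_le.
      repeat first [apply Rdiv_lt_0_compat | apply Rmult_lt_0_compat]; auto. }
    apply Rmult_le_compat_l with (1 := hd) in hk.
    eapply Rle_trans; [|eapply Rle_trans; [exact hk|]]; right; unfold d; field; repeat split; lra. }
  assert (H2 : Rabs (- (b ^ n / factR n * (INR n * flat_exp b m 1 t + b * flat_exp b m 2 t)))
     <= c * W).
  { rewrite Rabs_Ropp, Rabs_mult, (Rabs_pos_eq (b ^ n / factR n))
      by (apply Rlt_le, Rdiv_lt_0_compat; auto).
    assert (h1 : Rabs (INR n * flat_exp b m 1 t + b * flat_exp b m 2 t) <=
       2 ^ m * factR (1 + 2 * m) / (b * b ^ m) * INR (n + 2 * m + 2)).
    { apply Rle_trans with (1 := Rabs_triang _ _).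
      rewrite !Rabs_mult, (Rabs_pos_eq b), (Rabs_pos_eq (INR n)) by (apply pos_INR || lra).
      assert (q1 := Rmult_le_compat_l _ _ _ (pos_INR n) (flat_exp_bound b m hb 1 t)).
      assert (q2 := Rmult_le_compat_l _ _ _ (Rlt_le _ _ hb) (flat_exp_bound b m hb 2 t)).
      apply Rle_trans with (1 := Rplus_le_compat _ _ _ _ q1 q2).
      replace (2 + 2 * m)%nat with (S (1 + 2 * m)) by lia. rewrite (factR_S (1 + 2 * m)).
      replace (n + 2 * m + 2)%nat with (n + S (1 + 2 * m))%nat by lia.
      rewrite plus_INR. simpl (b ^ (2 + m)). simpl (b ^ (1 + m)).
      right. field. split; lra. }
    apply Rle_trans with (1 := Rmult_le_compat_l _ _ _
      (Rlt_le _ _ (Rdiv_lt_0_compat _ _ hbn hf)) h1).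
    assert (hk : factR n * factR (1 + 2 * m) * INR (n + 2 * m + 2) <= W).
    { unfold W. replace (n + 2 * m + 2)%nat with (S (n + (1 + 2 * m))) by lia.
      rewrite (factR_S (n + _)), (Rmult_comm (INR _)). apply Rmult_le_compat_r; [apply pos_INR|].
      rewrite <- (binom_fact n). generalize (binom_ge1 n (1 + 2 * m)). intros.
      assert (h5 := factR_pos (1 + 2 * m)).
      assert (0 < factR n * factR (1 + 2 * m)) by now apply Rmult_lt_0_compat.
      nra. }
    apply Rmult_le_compat_l with (1 := Rlt_le _ _ hc) in hk.
    eapply Rle_trans; [|exact hk]. right; unfold c; field; repeat split; lra. }
  apply Rle_trans with (1 := Rplus_le_compat _ _ _ _ H1 H2).
  replace (n + 2 * S m)%nat with (n + 2 * m + 2)%nat by lia. fold W.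
  simpl (b ^ S m). simpl (2 ^ S m). unfold c. right; field. repeat split; lra.
Qed.

Lemma cut_monomial_at_0 (b : R) (m : nat) : forall n,
  cut_monomial b m n 0 = if Nat.eq_dec n m then factR m else 0.
Proof.
induction m as [|m IH]; intros n.
- simpl (cut_monomial b 0). destruct n as [|n].
  + simpl. destruct Rle_dec; [|lra]. rewrite factR_0. ring.
  + rewrite cut_monomial0_S, flat_exp_nonpos by lra. destruct Nat.eq_dec; [lia|]. ring.
- rewrite cut_monomial_S, IH, !flat_exp_nonpos by lra. destruct n as [|n].
  + simpl (INR 0). destruct (Nat.eq_dec 0 (S m)); [lia|]. ring.
  + simpl (pred _). destruct (Nat.eq_dec n m) as [->|h].
    * destruct Nat.eq_dec; [|lia]. rewrite (factR_S m). ring.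
    * destruct Nat.eq_dec; [lia|]. ring.
Qed.

Lemma Series_single (m : nat) (c : R) :
  Series (fun n => if Nat.eq_dec n m then c else 0) = c.
Proof.
apply is_series_unique.
assert (h : forall N, sum_n (fun n => if Nat.eq_dec n m then c else 0) N =
   if Compare_dec.le_lt_dec m N then c else 0).
{ induction N as [|N IH].
  - rewrite sum_O. destruct Nat.eq_dec, Compare_dec.le_lt_dec; auto; lia.
  - rewrite sum_Sn, IH. match goal with |- plus ?x ?y = ?z => change (@eq R (x + y) z) end.
    destruct (Nat.eq_dec (S N) m); repeat destruct Compare_dec.le_lt_dec; try lia; ring. }
change (is_lim_seq (sum_n (fun n => if Nat.eq_dec n m then c else 0)) c).
apply is_lim_seq_ext_loc with (fun _ => c).
- exists m. intros N hN. rewrite h. destruct Compare_dec.le_lt_dec; auto; lia.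
- apply is_lim_seq_const.
Qed.

(** A truncated Borel-Laplace summation: [f = sum_n d_n / n! * cut_monomial b 0 n].
By [cut_monomial_bound] the m-th derivative is dominated by
[sum_n binom n (2m) * (4b/nu)^n], up to the factor [(2m)! (2/b)^m]. *)
Theorem borel_gevrey2 (b nu del : R) (d : nat -> R) :
  0 < b -> 4 * b < nu -> 0 <= del ->
  (forall n, Rabs (d n) <= del * factR (2 * n) / nu ^ n) ->
  exists f : nat -> R -> R,
    (forall T, tower (seg 0 T) f) /\
    (forall m t, 0 <= t -> Rabs (f m t) <=
       del / (1 - 4 * b / nu) * factR (2 * m) * (2 / (b * (1 - 4 * b / nu) ^ 2)) ^ m) /\
    (forall m, f m 0 = d m).
Proof.
intros hb hnu hdel hd.
set (q := 4 * b / nu).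
assert (hq : 0 <= q < 1).
{ unfold q. split; [apply Rlt_le, Rdiv_lt_0_compat; lra|].
  apply Rmult_lt_reg_r with nu; [lra|]. unfold Rdiv.
  rewrite Rmult_assoc, Rinv_l by lra. lra. }
(* The majorant of the m-th derivative of the n-th term, as a
   multiple of a term of the expansion of (1 - q)^(-2m-1). *)
set (B := fun m n : nat => del * (2 / b) ^ m * factR (2 * m) * (binom n (2 * m) * q ^ n)).
assert (hB : forall n m t, 0 <= t -> Rabs (d n / factR n * cut_monomial b m n t) <= B m n).
{ intros n m t ht. unfold Rdiv. rewrite !Rabs_mult.
  assert (hf := factR_pos n). assert (hif := Rinv_0_lt_compat _ hf).
  rewrite (Rabs_pos_eq (/ factR n)) by lra.
  apply Rle_trans with (del * factR (2 * n) / nu ^ n * / factR n *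
    (2 ^ m * b ^ n / b ^ m * factR (n + 2 * m) / (factR n * factR n))).
  { apply Rmult_le_compat; try apply Rabs_pos.
    - apply Rmult_le_pos; [apply Rabs_pos|lra].
    - apply Rmult_le_compat_r; [lra|auto].
    - now apply cut_monomial_bound. }
  unfold B, q, Rdiv. rewrite <- (binom_fact n), !Rpow_mult_distr, !pow_inv.
  assert (h4 : factR (2 * n) <= 4 ^ n * (factR n * factR n)) by apply factR_double_le.
  assert (hbn := pow_lt b n hb). assert (hbm := pow_lt b m hb).
  assert (hn := pow_lt nu n ltac:(lra)). assert (h2m := pow_lt 2 m ltac:(lra)).
  assert (hB := binom_ge1 n (2 * m)). assert (hf2 := factR_pos (2 * m)).
  set (c := del * / nu ^ n * / factR n * (2 ^ m * b ^ n * / b ^ m *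
     (binom n (2 * m) * factR n * factR (2 * m)) * / (factR n * factR n))).
  assert (hc : 0 <= c).
  { unfold c. repeat apply Rmult_le_pos; try lra; apply Rlt_le, Rinv_0_lt_compat; auto.
    now apply Rmult_lt_0_compat. }
  apply Rmult_le_compat_l with (1 := hc) in h4.
  eapply Rle_trans; [|eapply Rle_trans; [exact h4|]]; right; unfold c; field; repeat split; lra. }
assert (hs : forall m, ex_series (B m)).
{ intros m. apply @ex_series_scal. now apply series_binom_pow. }
exists (fun m t => Series (fun n => d n / factR n * cut_monomial b m n t)).
split; [|split].
- intros T. apply (tower_Series 0 T (fun n m t => d n / factR n * cut_monomial b m n t) B).
  + intros n. apply (tower_scal _ _ (fun m => cut_monomial b m n)). intros m t _.
    apply D_in_at, D_in_of_is_derive. now apply is_derive_cut_monomial.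
  + intros n m t [ht _]. auto.
  + exact hs.
- intros m t ht. apply Rle_trans with (Series (B m)).
  + apply Rabs_Series_le; auto.
  + unfold B. rewrite Series_scal_l.
    destruct (series_binom_pow q (2 * m) hq) as [_ h].
    assert (h0 : 0 <= del * (2 / b) ^ m * factR (2 * m)).
    { repeat apply Rmult_le_pos; auto; [|apply Rlt_le, factR_pos].
      apply pow_le, Rlt_le, Rdiv_lt_0_compat; lra. }
    apply Rle_trans with (1 := Rmult_le_compat_l _ _ _ h0 h).
    right. change ((/ (1 - q)) ^ S (2 * m)) with (/ (1 - q) * (/ (1 - q)) ^ (2 * m)).
    rewrite pow_mult.
    replace (2 / (b * (1 - q) ^ 2)) with (2 / b * (/ (1 - q)) ^ 2) by (field; lra).
    rewrite Rpow_mult_distr. unfold Rdiv. ring.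
- intros m. rewrite <- (Series_single m (d m)) at 1. apply Series_ext. intros n.
  rewrite cut_monomial_at_0. destruct Nat.eq_dec as [->|h]; [|ring].
  assert (hf := factR_pos m). field. lra.
Qed.

(** * Jets prescribed at both ends of an interval *)

Lemma flat_exp_0_0_pos (b t : R) : 0 < t -> 0 < flat_exp b 0 0 t.
Proof.
intros ht. rewrite flat_exp_0_pos by auto. simpl. rewrite Rdiv_1_r. apply exp_pos.
Qed.

(** The primitive of [exp(-b/t) exp(-b/(T - t))], normalized.  The constant in its
Gevrey estimate is governed by [b] alone and not by [T], which is why functions of Gevrey
order 2 are good enough as cutoffs. *)
Lemma cutoff (T X : R) : 0 < T -> 0 < X ->
  exists (chi : nat -> R -> R) (K : R), 0 < K /\ tower (seg 0 T) chi /\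
    (forall m t, seg 0 T t -> Rabs (chi m t) <= K * factR (2 * m) * X ^ m) /\
    chi 0%nat 0 = 1 /\ (forall m, chi (S m) 0 = 0) /\ (forall m, chi m T = 0).
Proof.
intros hT hX.
(* The exponential has constant 2/b = X/2; the bound by X for one of the two
   factors leaves the factor 2 that the Leibniz estimate needs. *)
set (b := 4 / X). assert (hb : 0 < b) by (apply Rdiv_lt_0_compat; lra).
set (p := fun m t => flat_exp b m 0 t).
(* The derivatives of exp(-b/(T - t)). *)
set (p' := fun (m : nat) t => (-1) ^ m * p m (T - t)).
set (h := fun m t => leibniz (fun i => p i t) (fun i => p' i t) m).
assert (tp : tower (seg 0 T) p).
{ intros m t _. apply D_in_at, D_in_of_is_derive. now apply is_derive_flat_exp. }
assert (th : tower (seg 0 T) h) by (apply tower_leibniz; auto; now apply tower_reflect).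
assert (h0 : forall t, h 0%nat t = p 0%nat t * p 0%nat (T - t)).
{ intros t. unfold h, leibniz, p'. simpl sum_f_R0. simpl binom. ring. }
assert (hc : forall t, continuous (h 0%nat) t).
{ intros t. apply continuous_ext with (fun t => p 0%nat t * p 0%nat (T - t)).
  { intros s; now rewrite h0. }
  apply (@ex_derive_continuous R_AbsRing R_NormedModule).
  exists (p 1%nat t * p 0%nat (T - t) + p 0%nat t * (- p 1%nat (T - t))).
  apply (is_derive_mult (p 0%nat) (fun t => p 0%nat (T - t))).
  - now apply is_derive_flat_exp.
  - evar_last. { apply (is_derive_comp (p 0%nat) (fun t => T - t)).
    - now apply is_derive_flat_exp.
    - auto_derive; [auto|]. reflexivity. }
    unfold scal; simpl; unfold mult; simpl. unfold p. simpl. ring.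
  - intros; apply Rmult_comm. }
assert (hi : forall a c, ex_RInt (h 0%nat) a c).
{ intros a c. apply (@ex_RInt_continuous R_CompleteNormedModule). intros; apply hc. }
set (I := RInt (h 0%nat) 0 T).
assert (hI : 0 < I).
{ apply RInt_gt_0; auto.
  intros t ht. rewrite h0. apply Rmult_lt_0_compat; apply flat_exp_0_0_pos; lra. }
assert (hpb : forall m t, Rabs (p m t) <= 1 * factR (2 * m) * (X / 2) ^ m).
{ intros m t. apply Rle_trans with (1 := flat_exp_bound b m hb 0 t). right.
  change (0 + 2 * m)%nat with (2 * m)%nat. change (0 + m)%nat with m.
  replace (X / 2) with (2 * / b) by (unfold b; field; lra).
  rewrite Rpow_mult_distr, pow_inv. unfold Rdiv. ring. }
assert (hpb' : forall m t, Rabs (p' m t) <= 1 * factR (2 * m) * (X / 2) ^ m).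
{ intros m t. unfold p'. rewrite Rabs_mult, pow_1_abs, Rmult_1_l. apply hpb. }
assert (hh : forall m t, Rabs (h m t) <= 2 * factR (2 * m) * X ^ m).
{ intros m t.
  replace (2 * factR (2 * m) * X ^ m) with (2 * 1 * 1 * factR (2 * m) * X ^ m) by ring.
  apply leibniz_gevrey2_bound; try lra; auto. intros i.
  apply Rle_trans with (1 := hpb i t).
  apply Rmult_le_compat_l; [generalize (factR_pos (2 * i)); lra|].
  apply pow_incr. lra. }
assert (hz : forall m, h m 0 = 0 /\ h m T = 0).
{ intros m. split; unfold h, leibniz; rewrite (sum_eq _ (fun _ => 0)), ?sum_cte; try ring;
  intros i _; unfold p', p.
  - rewrite (flat_exp_nonpos b i 0 0) by lra. ring.
  - rewrite (flat_exp_nonpos b (m - i) 0 (T - T)) by lra. ring. }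
(* The primitive is taken from t to T, so that the function falls
   from 1 to 0 and is flat at both ends. *)
exists (fun m t => match m with O => RInt (h 0%nat) t T / I | S k => - (/ I) * h k t end).
exists ((2 * T + 2 / X) / I).
assert (hXi : 0 < 2 / X) by (apply Rdiv_lt_0_compat; lra).
split; [apply Rdiv_lt_0_compat; lra|].
split; [|split; [|split; [|split]]].
- intros [|m] t ht.
  + apply D_in_at, D_in_of_is_derive.
    apply is_derive_ext with (fun t => / I * RInt (h 0%nat) t T).
    { intros s. unfold Rdiv. apply Rmult_comm. }
    replace (- / I * h 0%nat t) with (/ I * opp (h 0%nat t)) by (unfold opp; simpl; ring).
    apply is_derive_scal. apply (is_derive_RInt' (h 0%nat) (fun t => RInt (h 0%nat) t T) t T).
    * exists (mkposreal 1 Rlt_0_1). intros z _. apply (@RInt_correct R_CompleteNormedModule). auto.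
    * apply hc.
  + apply Dmult_const. now apply th.
- assert (hIi := Rinv_0_lt_compat _ hI).
  intros [|m] t ht.
  + unfold Rdiv at 1. rewrite Rabs_mult, (Rabs_pos_eq (/ I)) by lra.
    apply Rle_trans with ((T - t) * 2 * / I).
    * apply Rmult_le_compat_r; [lra|]. apply abs_RInt_le_const; [unfold seg in ht; lra|auto|].
      intros s _. apply Rle_trans with (1 := hh 0%nat s). simpl. rewrite factR_0. lra.
    * simpl. rewrite factR_0, !Rmult_1_r. unfold Rdiv at 1.
      apply Rmult_le_compat_r; [lra|]. unfold seg in ht. lra.
  + rewrite Rabs_mult, Rabs_Ropp, (Rabs_pos_eq (/ I)) by lra.
    apply Rle_trans with (1 := Rmult_le_compat_l _ _ _ (Rlt_le _ _ hIi) (hh m t)).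
    assert (hXm := pow_lt X m hX).
    assert (hf : factR (2 * m) <= factR (2 * S m)) by (apply factR_le; lia).
    assert (hf0 := factR_pos (2 * m)).
    simpl (X ^ S m).
    replace ((2 * T + 2 / X) / I * factR (2 * S m) * (X * X ^ m)) with
      (/ I * (2 * factR (2 * S m) * X ^ m) + 2 * T * / I * factR (2 * S m) * (X * X ^ m))
      by (field; lra).
    assert (0 <= 2 * T * / I * factR (2 * S m) * (X * X ^ m)).
    { repeat apply Rmult_le_pos; lra. }
    assert (/ I * (2 * factR (2 * m) * X ^ m) <= / I * (2 * factR (2 * S m) * X ^ m)).
    { apply Rmult_le_compat_l; [lra|]. apply Rmult_le_compat_r; lra. }
    lra.
- unfold I. field. unfold I in hI. lra.
- intros m. destruct (hz m) as [-> _]. ring.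
- intros [|m].
  + rewrite RInt_point. unfold zero; simpl. unfold Rdiv; ring.
  + destruct (hz m) as [_ ->]. ring.
Qed.

(** The function built for the left end times a cutoff, plus the mirror image of
the one built for the right end.  The cutoff has half the constant, hence the product loses
nothing. *)
Theorem two_point_borel_gevrey2 (T b nu : R) :
  0 < T -> 0 < b -> 4 * b < nu ->
  exists K, 0 < K /\ forall (del : R) (d e : nat -> R), 0 <= del ->
    (forall n, Rabs (d n) <= del * factR (2 * n) / nu ^ n) ->
    (forall n, Rabs (e n) <= del * factR (2 * n) / nu ^ n) ->
    exists g : nat -> R -> R, tower (seg 0 T) g /\
      (forall m t, seg 0 T t -> Rabs (g m t) <=
         K * del * factR (2 * m) * (2 / (b * (1 - 4 * b / nu) ^ 2)) ^ m) /\
      (forall m, g m 0 = d m) /\ (forall m, g m T = e m).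
Proof.
intros hT hb hnu.
set (q := 4 * b / nu).
assert (hq : 0 < 1 - q).
{ unfold q. apply Rmult_lt_reg_r with nu; [lra|]. unfold Rdiv.
  rewrite Rmult_0_l, Rmult_minus_distr_r, (Rmult_assoc (4 * b)), Rinv_l by lra. lra. }
set (X := 2 / (b * (1 - q) ^ 2)).
assert (hX : 0 < X).
{ apply Rdiv_lt_0_compat; [lra|]. apply Rmult_lt_0_compat; [lra|]. now apply pow_lt. }
destruct (cutoff T (X / 2) hT ltac:(lra)) as (chi & K & hK & tchi & bchi & c0 & cS & cT).
exists (4 * / (1 - q) * K). assert (hqi := Rinv_0_lt_compat _ hq).
split. { repeat apply Rmult_lt_0_compat; lra. }
intros del d e hdel hd he.
(* Reversing time changes the sign of the derivatives of odd order. *)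
set (e' := fun m => (-1) ^ m * e m).
assert (he' : forall n, Rabs (e' n) <= del * factR (2 * n) / nu ^ n).
{ intros n. unfold e'. rewrite Rabs_mult, pow_1_abs, Rmult_1_l. auto. }
destruct (borel_gevrey2 b nu del d hb hnu hdel hd) as (f & tf & bf & f0).
destruct (borel_gevrey2 b nu del e' hb hnu hdel he') as (f' & tf' & bf' & f0').
fold q in bf, bf'. fold X in bf, bf'.
set (k := fun (f : nat -> R -> R) m t => leibniz (fun i => f i t) (fun i => chi i t) m).
assert (bk : forall f, (forall m t, 0 <= t -> Rabs (f m t) <=
   del / (1 - q) * factR (2 * m) * X ^ m) -> forall m t, seg 0 T t ->
   Rabs (k f m t) <= 2 * (del / (1 - q)) * K * factR (2 * m) * X ^ m).
{ intros ff hff m t ht. apply leibniz_gevrey2_bound; try lra; auto.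
  - apply Rmult_le_pos; lra.
  - intros i. apply hff. apply ht. }
exists (fun m t => k f m t + (-1) ^ m * k f' m (T - t)).
split; [|split; [|split]].
- apply tower_add; [apply tower_leibniz; auto|].
  apply tower_reflect. apply tower_leibniz; auto.
- intros m t ht. apply Rle_trans with (1 := Rabs_triang _ _).
  rewrite Rabs_mult, pow_1_abs, Rmult_1_l.
  assert (h1 := bk f bf m t ht).
  assert (h2 := bk f' bf' m (T - t) ltac:(unfold seg in *; lra)).
  replace (4 * / (1 - q) * K * del * factR (2 * m) * X ^ m)
    with (2 * (2 * (del / (1 - q)) * K * factR (2 * m) * X ^ m)) by (field; lra).
  lra.
- intros m. unfold k. rewrite Rminus_0_r, leibniz_at_flat by auto.
  rewrite c0, f0, leibniz_at_flat, cT by auto. ring.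
- intros m. unfold k. unfold Rminus. rewrite Rplus_opp_r.
  rewrite leibniz_at_flat, cT, leibniz_at_flat, c0, f0' by auto. unfold e'.
  rewrite <- Rmult_assoc, Rmult_1_r.
  replace (f m T * 0) with 0 by ring.
  rewrite Rplus_0_l, <- Rmult_assoc, <- Rpow_mult_distr.
  replace (-1 * -1) with 1 by ring. rewrite pow1. ring.
Qed.

(** * The recursion between Taylor coefficients *)

(** Recursions in which the next term depends on all the previous ones and on a few
extra levels above the current index. *)
Lemma course_of_values {X : Type} (s : nat) (init : nat -> X)
  (step : (nat -> X) -> nat -> X) :
  (forall u v k, (forall j, (j < k + s)%nat -> u j = v j) -> step u k = step v k) ->
  exists u : nat -> X, (forall j, (j < s)%nat -> u j = init j) /\
    forall k, u (k + s)%nat = step u k.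
Proof.
intros hstep.
set (next := fun (u : nat -> X) n => if (n <? s)%nat then init n else step u (n - s)%nat).
set (tab := fix tab N := match N with O => init | S N' => next (tab N') end).
assert (H : forall n N N', (n < N)%nat -> (n < N')%nat -> tab N n = tab N' n).
{ induction n as [n IH] using (well_founded_induction Wf_nat.lt_wf).
  intros [|N] [|N'] h h'; try lia. simpl. unfold next.
  destruct (Nat.ltb_spec n s); auto. apply hstep. intros j hj. apply IH; lia. }
exists (fun n => tab (S n) n). split.
- intros j hj. simpl. unfold next. destruct (Nat.ltb_spec j s); auto; lia.
- intros k. simpl. unfold next. destruct (Nat.ltb_spec (k + s) s); [lia|].
  replace (k + s - s)%nat with k by lia. apply hstep. intros j hj.
  apply (H j (k + s)%nat (S j)); lia.
Qed.

(** The equation differentiated [n] times in [x] and [m] times in [t], and solved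
for the highest derivative in [x]. *)
Definition jet_relation (sg : R) (u : nat -> nat -> R) : Prop :=
  forall n m, u (n + 4)%nat m
    = sg * (u n (m + 2)%nat - u (n + 2)%nat m + conv u n m).

Lemma jet_relation_unique (sg : R) (u v : nat -> nat -> R) :
  jet_relation sg u -> jet_relation sg v ->
  (forall n m, (n < 4)%nat -> u n m = v n m) -> forall n m, u n m = v n m.
Proof.
intros hu hv h0.
induction n as [n IH] using (well_founded_induction Wf_nat.lt_wf). intros m.
destruct (Compare_dec.le_lt_dec 4 n) as [h|h]; [|auto].
replace n with ((n - 4) + 4)%nat by lia. rewrite hu, hv.
rewrite !IH by lia. rewrite (conv_ext u v); auto. intros; apply IH; lia.
Qed.

(** If [y] is odd in [x] then so is [2 y (dy/dx)]. *)
Lemma conv_even (u : nat -> nat -> R) (n m : nat) :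
  (forall j i, Nat.Even j -> (i <= m)%nat -> u j i = 0) -> Nat.Even n -> conv u n m = 0.
Proof.
intros hu hn. unfold conv.
rewrite (sum_eq _ (fun _ => 0)); [rewrite sum_cte; ring|].
intros j hj. unfold leibniz.
rewrite (sum_eq _ (fun _ => 0)); [rewrite sum_cte; ring|].
intros i hi.
destruct (Nat.Even_or_Odd j) as [[k hk]|[k hk]].
- rewrite (hu j i); [ring| |lia]. now exists k.
- rewrite (hu (S (n - j)) (m - i)%nat); [ring| |lia].
  destruct hn as [p hp]. exists (p - k)%nat. lia.
Qed.

Lemma Rabs_sum3_le (a b c A B C : R) :
  Rabs a <= A -> Rabs b <= B -> Rabs c <= C ->
  Rabs (a + b - c) <= A + B + C /\ Rabs (a - b + c) <= A + B + C.
Proof. intros. unfold Rabs in *. repeat destruct Rcase_abs; lra. Qed.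

(** The gain of two orders in the factorial, as a numerical factor. *)
Lemma factR_two_steps (k j : nat) (c : R) :
  (j <= k)%nat -> c <= INR (S (S j)) * INR (S j) -> c * factR k <= factR (S (S k)).
Proof.
intros hj hc. rewrite !factR_S, <- Rmult_assoc.
apply Rmult_le_compat_r; [apply Rlt_le, factR_pos|].
apply Rle_trans with (1 := hc).
apply Rmult_le_compat; try apply pos_INR; apply le_INR; lia.
Qed.

(** Solving the equation for the second time derivative determines the jets from
those of orders 0 and 1 in time.  Since [d n] vanishes for even [n], the term [d (n + 2)]
matters only when [n >= 1], where the gain of two factorials is at least [5 * 4 = 20]. *)
Theorem jets_exist (sg e X Z : R) (a0 a1 : nat -> R) :
  sg * sg = 1 -> Rabs sg = 1 -> 0 <= e -> 0 < X -> 0 < Z ->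
  Z ^ 2 * (/ X ^ 4 + / (20 * X ^ 2) + 2 * e / X) <= 1 ->
  (forall n, Rabs (a0 n) <= e * factR n / X ^ n) ->
  (forall n, Rabs (a1 n) <= e * factR n / (X ^ n * Z)) ->
  (forall n, Nat.Even n -> a0 n = 0 /\ a1 n = 0) ->
  exists d : nat -> nat -> R, jet_relation sg d /\
    (forall n, d n 0%nat = a0 n) /\ (forall n, d n 1%nat = a1 n) /\
    (forall n m, Nat.Even n -> d n m = 0) /\
    (forall n m, Rabs (d n m) <= e * factR (n + 2 * m) / (X ^ n * Z ^ m)).
Proof.
intros hsg hsg1 he hX hZ hXZ h0 h1 hev.
destruct (course_of_values 2 (fun m => match m with O => a0 | _ => a1 end)
  (fun u m n => sg * u m (n + 4)%nat + u m (n + 2)%nat - conv (fun j i => u i j) n m))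
  as (u & hinit & hrec).
{ intros u v k h. apply functional_extensionality. intros n.
  rewrite !h by lia. f_equal. apply conv_ext. intros. rewrite h; auto. lia. }
assert (hu0 := hinit 0%nat ltac:(lia)). assert (hu1 := hinit 1%nat ltac:(lia)).
simpl in hu0, hu1.
set (d := fun n m => u m n).
assert (hd : forall n m, d n (m + 2)%nat = sg * d (n + 4)%nat m + d (n + 2)%nat m - conv d n m).
{ intros n m. unfold d. now rewrite hrec. }
assert (dev : forall m n, Nat.Even n -> d n m = 0).
{ induction m as [m IH] using (well_founded_induction Wf_nat.lt_wf). intros n hn.
  destruct m as [|[|m]].
  - unfold d. rewrite hu0. now apply hev.
  - unfold d. rewrite hu1. now apply hev.
  - replace (S (S m)) with (m + 2)%nat by lia. destruct hn as [k hk].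
    rewrite hd, conv_even.
    + rewrite !IH; try lia; [ring | exists (k + 1)%nat; lia | exists (k + 2)%nat; lia].
    + intros; apply IH; auto; lia.
    + now exists k. }
exists d. split; [|split; [|split; [|split]]].
- intros n m. rewrite hd.
  transitivity (sg * sg * d (n + 4)%nat m); [rewrite hsg|]; ring.
- intros; unfold d; now rewrite hu0.
- intros; unfold d; now rewrite hu1.
- auto.
- intros n m. revert n.
  induction m as [m IH] using (well_founded_induction Wf_nat.lt_wf). intros n.
  assert (hXp : forall k, 0 < X ^ k) by (intro; now apply pow_lt).
  assert (hZp : forall k, 0 < Z ^ k) by (intro; now apply pow_lt).
  destruct m as [|[|m]].
  + unfold d. rewrite hu0. apply Rle_trans with (1 := h0 n).
    rewrite Nat.mul_0_r, Nat.add_0_r, Rmult_1_r. lra.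
  + unfold d. rewrite hu1. apply Rle_trans with (1 := h1 n). rewrite pow_1.
    apply Rmult_le_compat_r.
    * apply Rlt_le, Rinv_0_lt_compat, Rmult_lt_0_compat; auto.
    * apply Rmult_le_compat_l; auto. apply factR_le; lia.
  + destruct (Nat.Even_or_Odd n) as [hn|[k hk]].
    { rewrite dev, Rabs_R0 by auto. apply Rmult_le_pos.
      - apply Rmult_le_pos; auto. apply Rlt_le, factR_pos.
      - apply Rlt_le, Rinv_0_lt_compat, Rmult_lt_0_compat; auto. }
    replace (S (S m)) with (m + 2)%nat by lia. rewrite hd.
    set (F := factR (n + 4 + 2 * m)). assert (hF : 0 < F) by apply factR_pos.
    assert (b1 : Rabs (sg * d (n + 4)%nat m) <= e * F / (X ^ (n + 4) * Z ^ m)).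
    { rewrite Rabs_mult, hsg1, Rmult_1_l. apply IH. lia. }
    assert (b2 : Rabs (d (n + 2)%nat m) <= e * (F / 20) / (X ^ (n + 2) * Z ^ m)).
    { apply Rle_trans with (1 := IH m ltac:(lia) (n + 2)%nat).
      apply Rmult_le_compat_r.
      { apply Rlt_le, Rinv_0_lt_compat, Rmult_lt_0_compat; auto. }
      apply Rmult_le_compat_l; auto. unfold F.
      replace (n + 4 + 2 * m)%nat with (S (S (n + 2 + 2 * m))) by lia.
      assert (q := factR_two_steps (n + 2 + 2 * m) 3 20 ltac:(lia) ltac:(simpl; lra)). lra. }
    assert (b3 := conv_bound d n m e X Z he hX hZ (fun j i _ hi => IH i ltac:(lia) j)).
    fold F in b3.
    destruct (Rabs_sum3_le _ _ _ _ _ _ b1 b2 b3) as [b4 _].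
    apply Rle_trans with (1 := b4).
    replace (n + 2 * (m + 2))%nat with (n + 4 + 2 * m)%nat by lia. fold F.
    rewrite !pow_add. simpl (X ^ S n).
    assert (hc : 0 <= e * F / (X ^ n * Z ^ m * Z ^ 2)).
    { apply Rmult_le_pos; [apply Rmult_le_pos; lra|].
      apply Rlt_le, Rinv_0_lt_compat. repeat apply Rmult_lt_0_compat; auto; lra. }
    apply Rmult_le_compat_l with (1 := hc) in hXZ.
    specialize (hXp n). specialize (hZp m).
    eapply Rle_trans; [|eapply Rle_trans; [exact hXZ|]]; right; field; repeat split; lra.
Qed.

(** The recursion in [x] defines [A (n + 4)] from earlier coefficients and two more
of their time derivatives; the two orders in time cost four orders in the factorial,
which is what [n + 4] allows.  In the smallness condition the three terms
come from the second time derivative, from the second space derivative with the gain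
[4 * 3 = 12], and from the quadratic term. *)
Theorem cauchy_problem (sg T e lam mu : R) (g1 g3 : nat -> R -> R) :
  Rabs sg = 1 -> 0 <= e -> 0 < lam -> 0 < mu ->
  (lam ^ 2 / mu) ^ 2 + lam ^ 2 / 12 + 2 * e * lam ^ 3 <= 1 ->
  tower (seg 0 T) g1 -> tower (seg 0 T) g3 ->
  (forall m t, seg 0 T t -> Rabs (g1 m t) <= e * factR (1 + 2 * m) / (lam ^ 1 * mu ^ m)) ->
  (forall m t, seg 0 T t -> Rabs (g3 m t) <= e * factR (3 + 2 * m) / (lam ^ 3 * mu ^ m)) ->
  exists A : nat -> nat -> R -> R,
    (forall t, jet_relation sg (fun n m => A n m t)) /\
    (forall m t, A 0%nat m t = 0) /\ A 1%nat = g1 /\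
    (forall m t, A 2%nat m t = 0) /\ A 3%nat = g3 /\
    (forall n, tower (seg 0 T) (A n)) /\
    (forall n m t, seg 0 T t ->
       Rabs (A n m t) <= e * factR (n + 2 * m) / (lam ^ n * mu ^ m)).
Proof.
intros hsg he hl hm hsmall t1 t3 b1 b3.
set (z := fun (_ : nat) (_ : R) => 0).
destruct (course_of_values 4
  (fun n => match n with 1%nat => g1 | 3%nat => g3 | _ => z end)
  (fun u n m t => sg * (u n (m + 2)%nat t - u (n + 2)%nat m t
                        + conv (fun j i => u j i t) n m)))
  as (A & hinit & hrec).
{ intros u v k h. apply functional_extensionality; intros m.
  apply functional_extensionality; intros t.
  rewrite !h by lia. do 2 f_equal. apply conv_ext. intros. rewrite h; auto. lia. }
assert (A0 := hinit 0%nat ltac:(lia)). assert (A1 := hinit 1%nat ltac:(lia)).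
assert (A2 := hinit 2%nat ltac:(lia)). assert (A3 := hinit 3%nat ltac:(lia)).
cbv beta iota in A0, A1, A2, A3.
assert (hlp : forall k, 0 < lam ^ k) by (intro; now apply pow_lt).
assert (hmp : forall k, 0 < mu ^ k) by (intro; now apply pow_lt).
assert (tz : tower (seg 0 T) z).
{ intros m t _. apply D_in_at. apply (Dconst (seg 0 T) 0). }
assert (bz : forall n m t, Rabs (z m t) <= e * factR (n + 2 * m) / (lam ^ n * mu ^ m)).
{ intros n m t. unfold z. rewrite Rabs_R0. apply Rmult_le_pos.
  - apply Rmult_le_pos; auto. apply Rlt_le, factR_pos.
  - apply Rlt_le, Rinv_0_lt_compat, Rmult_lt_0_compat; auto. }
exists A. split; [|split; [|split; [|split; [|split; [|split]]]]]; auto.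
- intros t n m. now rewrite hrec.
- intros; now rewrite A0.
- intros; now rewrite A2.
- induction n as [n IH] using (well_founded_induction Wf_nat.lt_wf).
  destruct n as [|[|[|[|n]]]]; rewrite ?A0, ?A1, ?A2, ?A3; auto.
  replace (S (S (S (S n)))) with (n + 4)%nat by lia. rewrite hrec.
  apply (tower_scal _ sg (fun m t => A n (m + 2)%nat t - A (n + 2)%nat m t
                        + conv (fun j i => A j i t) n m)).
  apply (tower_add _ (fun m t => A n (m + 2)%nat t - A (n + 2)%nat m t)
     (fun m t => conv (fun j i => A j i t) n m)).
  + apply (tower_sub _ (fun m => A n (m + 2)%nat)); [apply tower_shift|]; apply IH; lia.
  + apply (tower_scal _ 2 (fun m t => sum_f_R0 (fun j => binom j (n - j) *
      leibniz (fun i => A j i t) (fun i => A (S (n - j)) i t) m) n)).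
    apply (tower_sum _ (fun j m t => binom j (n - j) *
      leibniz (fun i => A j i t) (fun i => A (S (n - j)) i t) m)).
    intros j hj. apply (tower_scal _ _ (fun m t =>
      leibniz (fun i => A j i t) (fun i => A (S (n - j)) i t) m)).
    apply tower_leibniz; apply IH; lia.
- induction n as [n IH] using (well_founded_induction Wf_nat.lt_wf). intros m t ht.
  destruct n as [|[|[|[|n]]]].
  1-4: rewrite ?A0, ?A1, ?A2, ?A3; auto.
  replace (S (S (S (S n)))) with (n + 4)%nat by lia. rewrite hrec.
  rewrite Rabs_mult, hsg, Rmult_1_l.
  set (F := factR (n + 4 + 2 * m)). assert (hF : 0 < F) by apply factR_pos.
  assert (c1 : Rabs (A n (m + 2)%nat t) <= e * F / (lam ^ n * mu ^ (m + 2))).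
  { apply Rle_trans with (1 := IH n ltac:(lia) (m + 2)%nat t ht).
    replace (n + 2 * (m + 2))%nat with (n + 4 + 2 * m)%nat by lia. apply Rle_refl. }
  assert (c2 : Rabs (A (n + 2)%nat m t) <= e * (F / 12) / (lam ^ (n + 2) * mu ^ m)).
  { apply Rle_trans with (1 := IH (n + 2)%nat ltac:(lia) m t ht).
    apply Rmult_le_compat_r.
    { apply Rlt_le, Rinv_0_lt_compat, Rmult_lt_0_compat; auto. }
    apply Rmult_le_compat_l; auto. unfold F.
    replace (n + 4 + 2 * m)%nat with (S (S (n + 2 + 2 * m))) by lia.
    assert (q := factR_two_steps (n + 2 + 2 * m) 2 12 ltac:(lia) ltac:(simpl; lra)). lra. }
  assert (c3 := conv_bound (fun j i => A j i t) n m e lam mu he hl hm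
    (fun j i hj _ => IH j ltac:(lia) i t ht)).
  fold F in c3.
  destruct (Rabs_sum3_le _ _ _ _ _ _ c1 c2 c3) as [_ c4].
  apply Rle_trans with (1 := c4).
  rewrite !pow_add. simpl (lam ^ S n).
  assert (hc : 0 <= e * F / (lam ^ n * lam ^ 4 * mu ^ m)).
  { apply Rmult_le_pos; [apply Rmult_le_pos; lra|].
    apply Rlt_le, Rinv_0_lt_compat. repeat apply Rmult_lt_0_compat; auto; lra. }
  apply Rmult_le_compat_l with (1 := hc) in hsmall.
  specialize (hlp n). specialize (hmp m).
  eapply Rle_trans; [|eapply Rle_trans; [exact hsmall|]]; right; field; repeat split; lra.
Qed.

(** * The power series in space *)

(** The derivative of order [p] in [x] and [m] in [t] of the sum of the power series
with coefficients [A n 0 t / n!]: differentiating in [x] shifts the index. *)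
Definition jet_series (A : nat -> nat -> R -> R) (p m : nat) (x t : R) : R :=
  PSeries (fun n => A (n + p)%nat m t / factR n) x.

Definition jet_bound (T e lam mu : R) (A : nat -> nat -> R -> R) : Prop :=
  forall n m t, seg 0 T t ->
    Rabs (A n m t) <= e * factR (n + 2 * m) / (lam ^ n * mu ^ m).

Lemma jet_coeff_bound (T e lam mu : R) (A : nat -> nat -> R -> R) (p m n : nat) (t r : R) :
  0 <= e -> 0 < lam -> 0 < mu -> 0 <= r -> jet_bound T e lam mu A -> seg 0 T t ->
  Rabs (A (n + p)%nat m t / factR n * r ^ n) <=
    e * factR (p + 2 * m) / (lam ^ p * mu ^ m) * (binom n (p + 2 * m) * (r / lam) ^ n).
Proof.
intros he hl hm hr hA ht. unfold Rdiv. rewrite !Rabs_mult.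
assert (hf := factR_pos n). assert (hrn := pow_le r n hr).
assert (hfi := Rinv_0_lt_compat _ hf).
assert (hln := pow_lt lam n hl). assert (hlp := pow_lt lam p hl). assert (hmm := pow_lt mu m hm).
rewrite (Rabs_pos_eq (/ factR n)), (Rabs_pos_eq (r ^ n)) by lra.
apply Rle_trans with
  (e * factR (n + p + 2 * m) / (lam ^ (n + p) * mu ^ m) * / factR n * r ^ n).
- apply Rmult_le_compat_r; auto. apply Rmult_le_compat_r; [lra|]. now apply hA.
- replace (n + p + 2 * m)%nat with (n + (p + 2 * m))%nat by lia.
  rewrite <- binom_fact, Rpow_mult_distr, pow_inv, pow_add. right. field. repeat split; lra.
Qed.

Lemma jet_series_radius (T e lam mu : R) (A : nat -> nat -> R -> R) (p m : nat) (x t : R) :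
  0 <= e -> 1 < lam -> 0 < mu -> jet_bound T e lam mu A -> seg 0 T t -> Rabs x <= 1 ->
  Rbar_lt (Rabs x) (CV_radius (fun n => A (n + p)%nat m t / factR n)).
Proof.
intros he hl hm hA ht hx.
(* Any radius strictly between 1 and lam would do. *)
apply Rbar_lt_le_trans with ((1 + lam) / 2); [simpl; lra|].
apply (proj1 (CV_radius_bounded _)).
exists (e * factR (p + 2 * m) / (lam ^ p * mu ^ m) *
   (/ (1 - ((1 + lam) / 2) / lam)) ^ S (p + 2 * m)).
intros n.
apply Rle_trans with (1 := jet_coeff_bound T e lam mu A p m n t ((1 + lam) / 2)
  he ltac:(lra) hm ltac:(lra) hA ht).
apply Rmult_le_compat_l.
- apply Rmult_le_pos; [apply Rmult_le_pos; auto; apply Rlt_le, factR_pos|].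
  apply Rlt_le, Rinv_0_lt_compat. apply Rmult_lt_0_compat; apply pow_lt; lra.
- apply binom_pow_le. split; [apply Rlt_le, Rdiv_lt_0_compat; lra|].
  apply Rmult_lt_reg_r with lam; [lra|]. unfold Rdiv. rewrite Rmult_assoc, Rinv_l; lra.
Qed.

Lemma is_derive_jet_series (T e lam mu : R) (A : nat -> nat -> R -> R) (p m : nat) (x t : R) :
  0 <= e -> 1 < lam -> 0 < mu -> jet_bound T e lam mu A -> seg 0 T t -> Rabs x <= 1 ->
  is_derive (fun x => jet_series A p m x t) x (jet_series A (S p) m x t).
Proof.
intros he hl hm hA ht hx.
evar_last.
- apply is_derive_PSeries. now apply jet_series_radius with T e lam mu.
- unfold jet_series. apply PSeries_ext. intros n. unfold PS_derive.
  replace (S n + p)%nat with (n + S p)%nat by lia. rewrite factR_S.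
  assert (hf := factR_pos n).
  assert (hn : INR (S n) <> 0) by (apply not_0_INR; lia). field. split; [lra|auto].
Qed.

(** The majorant of [jet_series] on [|x| <= 1], a binomial series in [1 / lam],
in closed form. *)
Definition jet_sum_bound (e lam mu : R) (p m : nat) : R :=
  e * factR (p + 2 * m) / (lam ^ p * mu ^ m) * (/ (1 - 1 / lam)) ^ S (p + 2 * m).

Lemma jet_term_summable (T e lam mu : R) (A : nat -> nat -> R -> R) (p m : nat) :
  0 <= e -> 1 < lam -> 0 < mu -> jet_bound T e lam mu A ->
  exists B : nat -> R, ex_series B /\ Series B <= jet_sum_bound e lam mu p m /\
    forall n x t, seg 0 T t -> Rabs x <= 1 ->
      Rabs (A (n + p)%nat m t / factR n * x ^ n) <= B n.
Proof.
intros he hl hm hA.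
assert (hq : 0 <= 1 / lam < 1).
{ split; [apply Rlt_le, Rdiv_lt_0_compat; lra|].
  apply Rmult_lt_reg_r with lam; [lra|]. unfold Rdiv. rewrite Rmult_assoc, Rinv_l; lra. }
destruct (series_binom_pow (1 / lam) (p + 2 * m) hq) as [hs hb].
exists (fun n => e * factR (p + 2 * m) / (lam ^ p * mu ^ m) *
  (binom n (p + 2 * m) * (1 / lam) ^ n)).
split; [|split].
- now apply @ex_series_scal.
- rewrite Series_scal_l. apply Rmult_le_compat_l; auto.
  apply Rmult_le_pos; [apply Rmult_le_pos; auto; apply Rlt_le, factR_pos|].
  apply Rlt_le, Rinv_0_lt_compat. apply Rmult_lt_0_compat; apply pow_lt; lra.
- intros n x t ht hx.
  apply Rle_trans with (2 := jet_coeff_bound T e lam mu A p m n t 1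
    he ltac:(lra) hm ltac:(lra) hA ht).
  rewrite !(Rabs_mult (_ / _)). apply Rmult_le_compat_l; [apply Rabs_pos|].
  rewrite pow1, Rabs_R1, <- RPow_abs, <- (pow1 n). apply pow_incr.
  split; [apply Rabs_pos|auto].
Qed.

Lemma jet_series_bound (T e lam mu : R) (A : nat -> nat -> R -> R) (p m : nat) (x t : R) :
  0 <= e -> 1 < lam -> 0 < mu -> jet_bound T e lam mu A -> seg 0 T t -> Rabs x <= 1 ->
  Rabs (jet_series A p m x t) <= jet_sum_bound e lam mu p m.
Proof.
intros he hl hm hA ht hx.
destruct (jet_term_summable T e lam mu A p m he hl hm hA) as (B & hB & hs & hb).
apply Rle_trans with (2 := hs). unfold jet_series, PSeries.
apply Rabs_Series_le; auto.
Qed.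

Lemma tower_jet_series (T e lam mu : R) (A : nat -> nat -> R -> R) (p : nat) (x : R) :
  0 <= e -> 1 < lam -> 0 < mu -> jet_bound T e lam mu A -> Rabs x <= 1 ->
  (forall n, tower (seg 0 T) (A n)) ->
  tower (seg 0 T) (fun m t => jet_series A p m x t).
Proof.
intros he hl hm hA hx hT m t ht. unfold jet_series, PSeries.
destruct (jet_term_summable T e lam mu A p m he hl hm hA) as (B & hB & _ & hb).
destruct (jet_term_summable T e lam mu A p (S m) he hl hm hA) as (B1 & hB1 & _ & hb1).
destruct (jet_term_summable T e lam mu A p (S (S m)) he hl hm hA) as (B2 & hB2 & _ & hb2).
assert (hd : forall n m s, seg 0 T s -> D_in (fun s => A (n + p)%nat m s / factR n * x ^ n)
  (fun s => A (n + p)%nat (S m) s / factR n * x ^ n) (seg 0 T) s).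
{ intros n k s hs. apply D_in_at.
  apply D_in_congr with (f := fun s => x ^ n / factR n * A (n + p)%nat k s)
    (l := x ^ n / factR n * A (n + p)%nat (S k) s); auto.
  - intros; unfold Rdiv; ring.
  - unfold Rdiv; ring.
  - apply (Dmult_const (seg 0 T) (A (n + p)%nat k) (A (n + p)%nat (S k))). now apply hT. }
apply (D_in_Series 0 T
  (fun n s => A (n + p)%nat m s / factR n * x ^ n)
  (fun n s => A (n + p)%nat (S m) s / factR n * x ^ n)
  (fun n s => A (n + p)%nat (S (S m)) s / factR n * x ^ n) B B1 B2); auto.
Qed.

Lemma jet_series_lipschitz (T e lam mu : R) (A : nat -> nat -> R -> R) (p m : nat)
  (x x' t t' : R) :
  0 <= e -> 1 < lam -> 0 < mu -> jet_bound T e lam mu A ->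
  (forall n, tower (seg 0 T) (A n)) ->
  seg 0 1 x -> seg 0 1 x' -> seg 0 T t -> seg 0 T t' ->
  Rabs (jet_series A p m x t - jet_series A p m x' t') <=
    jet_sum_bound e lam mu (S p) m * Rabs (x - x') +
    jet_sum_bound e lam mu p (S m) * Rabs (t - t').
Proof.
intros he hl hm hA hT hx hx' ht ht'.
assert (hu : forall x, seg 0 1 x -> Rabs x <= 1).
{ intros z [h0 h1]. now rewrite Rabs_pos_eq. }
replace (jet_series A p m x t - jet_series A p m x' t') with
  ((jet_series A p m x t - jet_series A p m x' t) +
   (jet_series A p m x' t - jet_series A p m x' t')) by ring.
apply Rle_trans with (1 := Rabs_triang _ _). apply Rplus_le_compat.
- apply (lipschitz_of_D_in 0 1 (fun x => jet_series A p m x t)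
    (fun x => jet_series A (S p) m x t)); auto.
  + intros z hz. apply D_in_at, D_in_of_is_derive.
    apply is_derive_jet_series with T e lam mu; auto.
  + intros z hz. apply jet_series_bound with T; auto.
- apply (lipschitz_of_D_in 0 T (fun t => jet_series A p m x' t)
    (fun t => jet_series A p (S m) x' t)); auto.
  + intros s hs. apply (tower_jet_series T e lam mu A p x'); auto.
  + intros s hs. apply jet_series_bound with T; auto.
Qed.

(** The case [m = 0] of [jet_relation], solved back for the second time
derivative and summed over [n]; the quadratic term is the Cauchy product of the series of
[y] and of its derivative. *)
Lemma jet_series_equation (T e lam mu sg : R) (A : nat -> nat -> R -> R) (x t : R) :
  0 <= e -> 1 < lam -> 0 < mu -> jet_bound T e lam mu A -> sg * sg = 1 ->
  jet_relation sg (fun n m => A n m t) -> seg 0 T t -> Rabs x <= 1 ->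
  jet_series A 0 2 x t = sg * jet_series A 4 0 x t + jet_series A 2 0 x t
    - 2 * (jet_series A 0 0 x t * jet_series A 1 0 x t).
Proof.
intros he hl hm hA hsg hrel ht hx.
assert (hr : forall p m, Rbar_lt (Rabs x) (CV_radius (fun n => A (n + p)%nat m t / factR n))).
{ intros p m. now apply jet_series_radius with T e lam mu. }
assert (hex : forall p m, ex_series (fun n => A (n + p)%nat m t / factR n * x ^ n)).
{ intros p m. apply ex_series_Rabs. now apply CV_disk_inside. }
unfold jet_series. rewrite <- PSeries_mult by auto.
set (a := PS_mult (fun n => A (n + 0)%nat 0%nat t / factR n)
   (fun n => A (n + 1)%nat 0%nat t / factR n)).
assert (ha : ex_series (fun n => a n * x ^ n)).
{ destruct (ex_pseries_mult (fun n => A (n + 0)%nat 0%nat t / factR n)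
   (fun n => A (n + 1)%nat 0%nat t / factR n) x) as [l h]; auto.
  exists l. revert h. apply is_series_ext. intros n. fold a.
  rewrite pow_n_pow. apply Rmult_comm. }
unfold PSeries. rewrite <- !Series_scal_l.
assert (h4 := ex_series_scal_l sg _ (hex 4%nat 0%nat)).
assert (ha2 := ex_series_scal_l 2 _ ha).
rewrite <- Series_plus, <- Series_minus; auto.
2: { apply (ex_series_plus (V := R_NormedModule)); auto. }
apply Series_ext. intros n.
assert (hc : conv (fun n m => A n m t) n 0 = 2 * factR n * a n).
{ unfold conv, a, PS_mult. rewrite Rmult_assoc. f_equal. rewrite scal_sum.
  apply sum_eq. intros j hj. unfold leibniz. cbn [sum_f_R0]. simpl (0 - 0)%nat.
  rewrite binom_0_r, Nat.add_0_r.
  replace (n - j + 1)%nat with (S (n - j)) by lia.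
  assert (hb := binom_fact j (n - j)). replace (j + (n - j))%nat with n in hb by lia.
  rewrite <- hb. generalize (factR_pos j), (factR_pos (n - j)). intros. field. lra. }
assert (hE := hrel n 0%nat). cbv beta in hE. simpl (0 + 2)%nat in hE.
rewrite Nat.add_0_r.
assert (hE' : A n 2%nat t = sg * A (n + 4)%nat 0%nat t + A (n + 2)%nat 0%nat t
   - conv (fun n m => A n m t) n 0).
{ rewrite hE. rewrite <- Rmult_assoc, hsg. ring. }
rewrite hE', hc. generalize (factR_pos n). intros. field. lra.
Qed.

(** * Regularity of the sum and the initial data *)

Lemma derive_on_congr (a b : R) (f g : R -> R) (x l : R) :
  a < b -> seg a b x -> (forall s, seg a b s -> g s = f s) ->
  D_in f (fun _ => l) (seg a b) x -> derive_on a b g x = l.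
Proof.
intros hab hx h H. apply derive_on_unique; auto.
apply D_in_congr with (f := f) (l := l); auto. intros; symmetry; auto.
Qed.

Lemma derive_n_on_tower (a b : R) (f : nat -> R -> R) : a < b -> tower (seg a b) f ->
  forall n x, seg a b x -> derive_n_on a b n (f 0%nat) x = f n x.
Proof.
intros hab hf. induction n as [|n IH]; intros x hx; [reflexivity|].
apply derive_on_congr with (f n); auto. now apply hf.
Qed.

Lemma smooth_on_tower (a b : R) (f : nat -> R -> R) : a < b -> tower (seg a b) f ->
  smooth_on a b (f 0%nat).
Proof.
intros hab hf n x hx. exists (f (S n) x).
apply D_in_congr with (f := f n) (l := f (S n) x); auto.
- intros; symmetry; now apply derive_n_on_tower.
- now apply hf.
Qed.

Lemma Rpower_factR_2 (n : nat) : Rpower (INR (fact n)) 2 = factR n * factR n.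
Proof.
replace 2 with (INR 2) by (simpl; ring).
rewrite Rpower_pow by apply (factR_pos n). unfold factR. simpl. ring.
Qed.

Lemma gevrey2_of_tower (T M r : R) (f : nat -> R -> R) : 0 < T -> 0 < M -> 0 < r ->
  tower (seg 0 T) f ->
  (forall m t, seg 0 T t -> Rabs (f m t) <= M * (factR m * factR m) / r ^ m) ->
  gevrey 2 0 T (f 0%nat).
Proof.
intros hT hM hr tf hf. split; [now apply smooth_on_tower|].
exists M, r. repeat split; auto. intros m t ht.
rewrite derive_n_on_tower, Rpower_factR_2; auto.
Qed.

Definition agrees_on_box (a b c d : R) (y z : R -> R -> R) : Prop :=
  forall x t, seg a b x -> seg c d t -> y x t = z x t.

(** Joint continuity is a separate clause, as it does not follow from the
existence of the partial derivatives. *)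
Definition bitower (a b c d : R) (Y : nat -> nat -> R -> R -> R) : Prop :=
  (forall p m x t, seg a b x -> seg c d t ->
     D_in (fun x => Y p m x t) (fun x => Y (S p) m x t) (seg a b) x) /\
  (forall p m x t, seg a b x -> seg c d t ->
     D_in (Y p m x) (Y p (S m) x) (seg c d) t) /\
  (forall p m, continuous_on (box a b c d) (fun q => Y p m (fst q) (snd q))).

Lemma partial_x_agrees (a b c d : R) (Y : nat -> nat -> R -> R -> R)
  (y : R -> R -> R) (p m : nat) : a < b -> bitower a b c d Y ->
  agrees_on_box a b c d y (Y p m) -> agrees_on_box a b c d (partial_x a b y) (Y (S p) m).
Proof.
intros hab hY h x t hx ht. destruct hY as [h1 _].
apply derive_on_congr with (fun x => Y p m x t); auto. now apply (h1 p m).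
Qed.

Lemma partial_t_agrees (a b c d : R) (Y : nat -> nat -> R -> R -> R)
  (y : R -> R -> R) (p m : nat) : c < d -> bitower a b c d Y ->
  agrees_on_box a b c d y (Y p m) -> agrees_on_box a b c d (partial_t c d y) (Y p (S m)).
Proof.
intros hcd hY h x t hx ht. destruct hY as [_ [h1 _]].
apply derive_on_congr with (Y p m x); auto. now apply (h1 p m).
Qed.

Lemma partial_n_x_agrees (a b c d : R) (Y : nat -> nat -> R -> R -> R)
  (y : R -> R -> R) (p m n : nat) : a < b -> bitower a b c d Y ->
  agrees_on_box a b c d y (Y p m) ->
  agrees_on_box a b c d (partial_n_x a b n y) (Y (n + p)%nat m).
Proof.
intros hab hY h. induction n as [|n IH]; [exact h|]. now apply partial_x_agrees.
Qed.

Lemma partial_n_t_agrees (a b c d : R) (Y : nat -> nat -> R -> R -> R)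
  (y : R -> R -> R) (p m n : nat) : c < d -> bitower a b c d Y ->
  agrees_on_box a b c d y (Y p m) ->
  agrees_on_box a b c d (partial_n_t c d n y) (Y p (n + m)%nat).
Proof.
intros hcd hY h. induction n as [|n IH]; [exact h|]. now apply partial_t_agrees.
Qed.

(** The condition on [y] is only through its values on the box, and this lets the
induction run through the iterated one-sided derivatives, which are known only there. *)
Lemma Ck_box_agrees (a b c d : R) (Y : nat -> nat -> R -> R -> R) (k : nat) :
  a < b -> c < d -> bitower a b c d Y ->
  forall (y : R -> R -> R) (p m : nat),
  agrees_on_box a b c d y (Y p m) -> Ck_box a b c d k y.
Proof.
intros hab hcd hY.
assert (hc : forall y p m, agrees_on_box a b c d y (Y p m) ->
  continuous_on (box a b c d) (fun q => y (fst q) (snd q))).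
{ intros y p m h. destruct hY as [_ [_ h1]].
  apply continuous_on_ext with (2 := h1 p m).
  intros z hz. symmetry. apply h; apply hz. }
induction k as [|k IH]; intros y p m h.
- split; [now apply hc with p m|exact I].
- split; [now apply hc with p m|]. split; [|split].
  + intros x t hx ht. destruct hY as [h1 [h2 _]]. split.
    * exists (Y (S p) m x t).
      apply D_in_congr with (f := fun x => Y p m x t) (l := Y (S p) m x t); auto.
      { intros s hs. symmetry; auto. }
      now apply (h1 p m).
    * exists (Y p (S m) x t).
      apply D_in_congr with (f := Y p m x) (l := Y p (S m) x t); auto.
      { intros s hs. symmetry; auto. }
      now apply (h2 p m).
  + now apply (IH _ (S p) m), partial_x_agrees.
  + now apply (IH _ p (S m)), partial_t_agrees.
Qed.

Lemma bitower_jet_series (T e lam mu : R) (A : nat -> nat -> R -> R) :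
  0 <= e -> 1 < lam -> 0 < mu -> jet_bound T e lam mu A ->
  (forall n, tower (seg 0 T) (A n)) -> bitower 0 1 0 T (jet_series A).
Proof.
intros he hl hm hA hT.
assert (hu : forall x, seg 0 1 x -> Rabs x <= 1).
{ intros z [h0 h1]. now rewrite Rabs_pos_eq. }
split; [|split].
- intros p m x t hx ht. apply D_in_at, D_in_of_is_derive.
  apply is_derive_jet_series with T e lam mu; auto.
- intros p m x t hx ht. apply (tower_jet_series T e lam mu A p x); auto.
- intros p m q [hx ht]. apply filterlim_locally. intros eps.
  set (M1 := Rabs (jet_sum_bound e lam mu (S p) m)).
  set (M2 := Rabs (jet_sum_bound e lam mu p (S m))).
  assert (h1 := Rabs_pos (jet_sum_bound e lam mu (S p) m)).
  assert (h2 := Rabs_pos (jet_sum_bound e lam mu p (S m))).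
  fold M1 in h1. fold M2 in h2.
  assert (hd : 0 < eps / (M1 + M2 + 1)).
  { apply Rdiv_lt_0_compat; [apply cond_pos|lra]. }
  exists (mkposreal _ hd). intros q' [b1 b2] [hx' ht'].
  assert (b1' : Rabs (fst q' - fst q) < eps / (M1 + M2 + 1)) by exact b1.
  assert (b2' : Rabs (snd q' - snd q) < eps / (M1 + M2 + 1)) by exact b2.
  change (Rabs (jet_series A p m (fst q') (snd q') - jet_series A p m (fst q) (snd q)) < eps).
  apply Rle_lt_trans with (1 := jet_series_lipschitz T e lam mu A p m _ _ _ _
     he hl hm hA hT hx' hx ht' ht).
  assert (h3 := Rle_abs (jet_sum_bound e lam mu (S p) m)).
  assert (h4 := Rle_abs (jet_sum_bound e lam mu p (S m))).
  fold M1 in h3. fold M2 in h4.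
  apply Rle_lt_trans with (M1 * (eps / (M1 + M2 + 1)) + M2 * (eps / (M1 + M2 + 1))).
  + apply Rplus_le_compat;
      [apply Rle_trans with (1 := Rmult_le_compat_r _ _ _ (Rabs_pos _) h3)
      |apply Rle_trans with (1 := Rmult_le_compat_r _ _ _ (Rabs_pos _) h4)];
      apply Rmult_le_compat_l; auto; now apply Rlt_le.
  + assert (hE : eps = (M1 + M2 + 1) * (eps / (M1 + M2 + 1)) :> R) by (field; lra).
    set (w := eps / (M1 + M2 + 1)) in *. clearbody w. lra.
Qed.

Lemma jet_sum_bound_gevrey (e lam mu : R) (p m : nat) :
  0 < e -> 1 < lam -> 0 < mu ->
  let L := / (1 - 1 / lam) in
  jet_sum_bound e lam mu p m <= e * L * factR p * (factR m * factR m) /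
    ((lam / (2 * L)) ^ p * (mu / (16 * L ^ 2)) ^ m).
Proof.
intros he hl hm L.
assert (hL : 0 < L).
{ apply Rinv_0_lt_compat. apply Rmult_lt_reg_r with lam; [lra|].
  rewrite Rmult_0_l. replace ((1 - 1 / lam) * lam) with (lam - 1) by (field; lra). lra. }
unfold jet_sum_bound. fold L.
assert (h1 := factR_plus_le p (2 * m)). assert (h2 := factR_double_le m).
assert (hp := factR_pos p). assert (hmm := factR_pos m).
assert (h3 : factR (p + 2 * m) <= 2 ^ p * 16 ^ m * (factR p * (factR m * factR m))).
{ apply Rle_trans with (1 := h1). rewrite pow_add, pow_mult.
  replace (16 ^ m) with (4 ^ m * 4 ^ m) by (rewrite <- Rpow_mult_distr; f_equal; ring).
  replace (2 ^ 2) with 4 by ring.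
  assert (h5 : 0 <= 2 ^ p * 4 ^ m * factR p).
  { repeat apply Rmult_le_pos; try apply pow_le; lra. }
  apply Rmult_le_compat_l with (1 := h5) in h2. lra. }
assert (hc : 0 <= e * L * (L ^ p * L ^ (2 * m)) / (lam ^ p * mu ^ m)).
{ apply Rmult_le_pos.
  - repeat apply Rmult_le_pos; try apply pow_le; lra.
  - apply Rlt_le, Rinv_0_lt_compat, Rmult_lt_0_compat; apply pow_lt; lra. }
apply Rmult_le_compat_l with (1 := hc) in h3.
assert (q1 := pow_lt lam p ltac:(lra)). assert (q2 := pow_lt mu m hm).
assert (q3 := pow_lt L p hL). assert (q4 := pow_lt (L ^ 2) m (pow_lt _ _ hL)).
assert (q5 := pow_lt 2 p ltac:(lra)). assert (q6 := pow_lt 16 m ltac:(lra)).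
change (L ^ S (p + 2 * m)) with (L * L ^ (p + 2 * m)).
assert (hdiv : forall u v k, (u / v) ^ k = u ^ k / v ^ k).
{ intros u v k. unfold Rdiv. now rewrite Rpow_mult_distr, pow_inv. }
rewrite !hdiv, !Rpow_mult_distr, pow_add. rewrite pow_mult in *.
eapply Rle_trans; [|eapply Rle_trans; [exact h3|]]; right; field; repeat split; lra.
Qed.

(** By oddness [z x = (z x - z (-x)) / 2], so the coefficients of even order may be
replaced by [0] without appeal to the uniqueness of the expansion. *)
Lemma class_R_odd_jet (r c : R) (z : R -> R) : 18 <= r -> class_R r c z -> odd_on z ->
  0 <= c ->
  exists a : nat -> R, (forall n, Rabs (a n) <= c * factR n / 18 ^ n) /\
    (forall n, Nat.Even n -> a n = 0) /\
    forall x, seg 0 1 x -> Series (fun n => a n / factR n * x ^ n) = z x.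
Proof.
intros hr [al [hal hz]] hodd hc.
exists (fun n => if Nat.even n then 0 else al n). split; [|split].
- intros n. assert (hf := factR_pos n). assert (h18 := pow_lt 18 n ltac:(lra)).
  assert (hb : c * INR (fact n) / r ^ n <= c * factR n / 18 ^ n).
  { apply Rmult_le_compat_l; [apply Rmult_le_pos; [auto|apply Rlt_le, (factR_pos n)]|].
    apply Rinv_le_contravar; auto. apply pow_incr. lra. }
  destruct (Nat.even n).
  + rewrite Rabs_R0. apply Rmult_le_pos; [apply Rmult_le_pos; lra|].
    now apply Rlt_le, Rinv_0_lt_compat.
  + exact (Rle_trans _ _ _ (hal n) hb).
- intros n hn. apply Nat.even_spec in hn. now rewrite hn.
- intros x hx. apply is_series_unique.
  assert (h1 := hz x ltac:(unfold seg in *; lra)).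
  assert (h2 := hz (- x) ltac:(unfold seg in *; lra)).
  rewrite hodd in h2 by (unfold seg in *; lra).
  replace (z x) with (/ 2 * (z x - - z x)) by field.
  assert (h3 := is_series_scal_l (/ 2) _ _ (is_series_minus _ _ _ _ h1 h2)).
  revert h3. apply is_series_ext. intros n.
  change (/ 2 * (al n * x ^ n / INR (fact n) - al n * (- x) ^ n / INR (fact n)) =
    (if Nat.even n then 0 else al n) / factR n * x ^ n).
  replace (- x) with (-1 * x) by ring. rewrite Rpow_mult_distr. unfold factR.
  assert (hf : INR (fact n) <> 0) by apply INR_fact_neq_0.
  destruct (Nat.even n) eqn:E.
  + apply Nat.even_spec in E. destruct E as [k ->]. rewrite pow_1_even. field; auto.
  + assert (ho : Nat.odd n = true) by (unfold Nat.odd; now rewrite E).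
    apply Nat.odd_spec in ho. destruct ho as [k ->].
    replace (2 * k + 1)%nat with (S (2 * k)) in * by lia. rewrite pow_1_odd. field; auto.
Qed.

Lemma R_hat_ge : 18 <= R_hat.
Proof.
unfold R_hat. assert (h := exp_le_3). assert (h0 := exp_pos 1).
assert (h1 := exp_ineq1_le (/ (2 * exp 1))).
assert (h2 : / 6 <= / (2 * exp 1)) by (apply Rinv_le_contravar; lra). lra.
Qed.

(** Since [72/75 <= (49/50)^2], the ratio [(2m + 3)! / (2m)!], which is
[6 * binom (2m) 3], is absorbed by [binom_pow_le] with [q = 49/50]. *)
Lemma jet_bound_absorb (e : R) (d : nat -> nat -> R) (n m : nat) : (n <= 3)%nat -> 0 <= e ->
  Rabs (d n m) <= e * factR (n + 2 * m) / (18 ^ n * 75 ^ m) ->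
  Rabs (d n m) <= e * (6 * 50 ^ 4) * factR (2 * m) / 72 ^ m.
Proof.
intros hn he hd.
assert (h75 := pow_lt 75 m ltac:(lra)). assert (h72 := pow_lt 72 m ltac:(lra)).
assert (h18 := pow_R1_Rle 18 n ltac:(lra)).
apply Rle_trans with (1 := hd).
apply Rle_trans with (e * factR (3 + 2 * m) / 75 ^ m).
- apply Rmult_le_compat.
  + apply Rmult_le_pos; auto. apply Rlt_le, factR_pos.
  + apply Rlt_le, Rinv_0_lt_compat, Rmult_lt_0_compat; lra.
  + apply Rmult_le_compat_l; auto. apply factR_le; lia.
  + apply Rinv_le_contravar; auto. nra.
- assert (hb := binom_pow_le (49 / 50) 3 (2 * m) ltac:(lra)).
  replace (/ (1 - 49 / 50)) with 50 in hb by field.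
  assert (hq : (72 / 75) ^ m <= (49 / 50) ^ (2 * m)).
  { rewrite pow_mult. apply pow_incr. lra. }
  assert (hB := binom_ge1 (2 * m) 3).
  assert (hb' : binom (2 * m) 3 * (72 / 75) ^ m <= 50 ^ 4) by nra.
  replace (3 + 2 * m)%nat with (2 * m + 3)%nat by lia.
  rewrite <- binom_fact. replace (factR 3) with 6 by (unfold factR; simpl; ring).
  unfold Rdiv in hb'. rewrite Rpow_mult_distr, pow_inv in hb'.
  assert (hc : 0 <= e * 6 * factR (2 * m) / 72 ^ m).
  { apply Rmult_le_pos; [|now apply Rlt_le, Rinv_0_lt_compat].
    generalize (factR_pos (2 * m)); intros; repeat apply Rmult_le_pos; lra. }
  apply Rmult_le_compat_l with (1 := hc) in hb'.
  eapply Rle_trans; [|eapply Rle_trans; [exact hb'|]]; right; field; lra.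
Qed.

(** * The exact controllability theorem *)

Lemma jet_series_at (A : nat -> nat -> R -> R) (a : nat -> R) (z : R -> R) (m : nat) (x t : R) :
  (forall n, A n m t = a n) -> Series (fun n => a n / factR n * x ^ n) = z x ->
  jet_series A 0 m x t = z x.
Proof.
intros hA <-. apply Series_ext. intros n. now rewrite Nat.add_0_r, hA.
Qed.

Lemma odd_jets (sg r c : R) (z0 z1 : R -> R) :
  sg * sg = 1 -> Rabs sg = 1 -> 18 <= r -> 0 <= c <= / 10000 ->
  class_R r (c / 75) z0 -> class_R r (c / 75) z1 -> odd_on z0 -> odd_on z1 ->
  exists d : nat -> nat -> R, jet_relation sg d /\
    (forall n m, Nat.Even n -> d n m = 0) /\
    (forall n m, Rabs (d n m) <= c * factR (n + 2 * m) / (18 ^ n * 75 ^ m)) /\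
    (forall x, seg 0 1 x -> Series (fun n => d n 0%nat / factR n * x ^ n) = z0 x) /\
    (forall x, seg 0 1 x -> Series (fun n => d n 1%nat / factR n * x ^ n) = z1 x).
Proof.
intros hsg hsg1 hr hc h0 h1 o0 o1.
destruct (class_R_odd_jet r (c / 75) z0 hr h0 o0 ltac:(lra)) as (a0 & b0 & e0 & s0).
destruct (class_R_odd_jet r (c / 75) z1 hr h1 o1 ltac:(lra)) as (a1 & b1 & e1 & s1).
assert (hb : forall n, 0 <= factR n / 18 ^ n).
{ intros n. apply Rlt_le, Rdiv_lt_0_compat; [apply factR_pos|apply pow_lt; lra]. }
destruct (jets_exist sg c 18 75 a0 a1) as (d & hd & hd0 & hd1 & hev & hbd); try lra; auto.
- intros n. apply Rle_trans with (1 := b0 n). unfold Rdiv. specialize (hb n).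
  unfold Rdiv in hb. nra.
- intros n. apply Rle_trans with (1 := b1 n).
  assert (h18 : 18 ^ n <> 0) by (apply pow_nonzero; lra). right. field. auto.
- exists d. split; [|split; [|split; [|split]]]; auto.
  + intros x hx. rewrite <- s0 by auto. apply Series_ext. intros n. now rewrite hd0.
  + intros x hx. rewrite <- s1 by auto. apply Series_ext. intros n. now rewrite hd1.
Qed.

Theorem theorem2p4 (sg r T : R) (hsg : sg = 1 \/ sg = -1)
  (hr : r > R_hat) (hT : T > 0) :
  exists Chat : R, Chat > 0 /\
    forall y0 y1 yT0 yT1 : R -> R,
      class_R r Chat y0 -> class_R r Chat y1 ->
      class_R r Chat yT0 -> class_R r Chat yT1 ->
      odd_on y0 -> odd_on y1 -> odd_on yT0 -> odd_on yT1 ->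
      exists (y : R -> R -> R) (v w : R -> R),
        gevrey2 1 2 0 1 0 T y /\ gevrey 2 0 T v /\ gevrey 2 0 T w /\
        (forall x t : R, 0 <= x <= 1 -> 0 <= t <= T ->
           partial_n_t 0 T 2 y x t
           = sg * partial_n_x 0 1 4 y x t + partial_n_x 0 1 2 y x t
             - partial_x 0 1 (fun x' t' => (y x' t') ^ 2) x t) /\
        (forall t : R, 0 <= t <= T ->
           y 0 t = 0 /\ y 1 t = v t /\
           partial_n_x 0 1 2 y 0 t = 0 /\ partial_n_x 0 1 2 y 1 t = w t) /\
        (forall x : R, 0 <= x <= 1 ->
           y x 0 = y0 x /\ partial_t 0 T y x 0 = y1 x) /\
        (forall x : R, 0 <= x <= 1 ->
           y x T = yT0 x /\ partial_t 0 T y x T = yT1 x).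
Proof.
assert (hsg2 : sg * sg = 1) by (destruct hsg as [-> | ->]; ring).
assert (hsg1 : Rabs sg = 1) by (destruct hsg as [-> | ->]; [apply Rabs_R1 | apply Rabs_m1]).
assert (hr18 : 18 <= r) by (generalize R_hat_ge; lra).
destruct (two_point_borel_gevrey2 T 6 72) as (K & hK & interp); try lra.
set (lam := 21 / 20). set (mu := 4 / 3).
set (P := 6 * 50 ^ 4) in *. assert (hP : 0 < P) by (unfold P; lra).
assert (hlam : 0 < lam ^ 3) by (unfold lam; lra).
assert (hQ : 0 < 20 * lam ^ 3 * K * P).
{ apply Rmult_lt_0_compat; auto. apply Rmult_lt_0_compat; lra. }
(* The first bound is what the estimate of the jets asks for, the second
   one makes e at most 1/20, as the recursion in x requires. *)
set (c := Rmin (/ 10000) (/ (20 * lam ^ 3 * K * P))).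
assert (hc : 0 < c).
{ apply Rmin_glb_lt; [lra|]. now apply Rinv_0_lt_compat. }
assert (hc1 : c <= / 10000) by apply Rmin_l.
assert (hc2 : c <= / (20 * lam ^ 3 * K * P)) by apply Rmin_r.
(* K * (c * P) bounds the two traces; the factor lam ^ 3 puts this bound into
   the form of the majorant for n = 3, and for n = 1 a fortiori. *)
set (e := lam ^ 3 * K * P * c).
assert (he : 0 < e).
{ unfold e. repeat apply Rmult_lt_0_compat; lra. }
assert (he1 : e <= / 20).
{ apply Rmult_le_compat_l with (r := 20 * lam ^ 3 * K * P) in hc2; [|lra].
  rewrite Rinv_r in hc2 by lra. unfold e. lra. }
exists (c / 75). split; [lra|].
intros y0 y1 yT0 yT1 c0 c1 cT0 cT1 o0 o1 oT0 oT1.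
destruct (odd_jets sg r c y0 y1) as (d & rd & evd & bd & s0 & s1); auto; [lra|].
destruct (odd_jets sg r c yT0 yT1) as (dT & rdT & evdT & bdT & sT0 & sT1); auto; [lra|].
assert (hdel : 0 <= c * P) by (apply Rmult_le_pos; lra).
assert (hab : forall n m, (n <= 3)%nat -> Rabs (d n m) <= c * P * factR (2 * m) / 72 ^ m).
{ intros n m hn. apply jet_bound_absorb; auto; lra. }
assert (habT : forall n m, (n <= 3)%nat -> Rabs (dT n m) <= c * P * factR (2 * m) / 72 ^ m).
{ intros n m hn. apply jet_bound_absorb; auto; lra. }
destruct (interp (c * P) (d 1%nat) (dT 1%nat) hdel) as (g1 & t1 & b1 & g10 & g1T);
  [intros; apply hab; lia | intros; apply habT; lia |].
destruct (interp (c * P) (d 3%nat) (dT 3%nat) hdel) as (g3 & t3 & b3 & g30 & g3T);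
  [intros; apply hab; lia | intros; apply habT; lia |].
(* The choice b = 6 gives 4 b / nu = 1/3, which maximizes the resulting
   constant. *)
assert (hX : 2 / (6 * (1 - 4 * 6 / 72) ^ 2) = / mu) by (unfold mu; field).
rewrite hX in b1, b3.
assert (hg : forall g j, (j = 1 \/ j = 3)%nat ->
  (forall m t, seg 0 T t -> Rabs (g m t) <= K * (c * P) * factR (2 * m) * (/ mu) ^ m) ->
  forall m t, seg 0 T t -> Rabs (g m t) <= e * factR (j + 2 * m) / (lam ^ j * mu ^ m)).
{ intros g j hj hb m t ht. apply Rle_trans with (1 := hb m t ht).
  assert (hmu : 0 < mu ^ m) by (apply pow_lt; unfold mu; lra).
  assert (hlj : 0 < / lam ^ j /\ / lam ^ 3 <= / lam ^ j).
  { assert (hlp := pow_lt lam j ltac:(unfold lam; lra)).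
    split; [now apply Rinv_0_lt_compat|]. apply Rinv_le_contravar; auto.
    apply Rle_pow; [unfold lam; lra|lia]. }
  assert (hf := factR_le (2 * m) (j + 2 * m) ltac:(lia)).
  assert (hf0 := factR_pos (2 * m)).
  rewrite pow_inv.
  replace (K * (c * P) * factR (2 * m) * / mu ^ m) with
    (e * / mu ^ m * (factR (2 * m) * / lam ^ 3)) by (unfold e; field; split; [lra|unfold lam; lra]).
  unfold Rdiv. rewrite Rinv_mult.
  replace (e * factR (j + 2 * m) * (/ lam ^ j * / mu ^ m)) with
    (e * / mu ^ m * (factR (j + 2 * m) * / lam ^ j)) by ring.
  apply Rmult_le_compat_l.
  - apply Rmult_le_pos; [lra|]. now apply Rlt_le, Rinv_0_lt_compat.
  - apply Rmult_le_compat; try lra. apply Rlt_le, Rinv_0_lt_compat. lra. }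
destruct (cauchy_problem sg T e lam mu g1 g3) as (A & rA & A0 & A1 & A2 & A3 & tA & bA);
  auto; try (unfold lam, mu in *; lra).
assert (hA : jet_bound T e lam mu A) by exact bA.
assert (hl1 : 1 < lam) by (unfold lam; lra). assert (hm0 : 0 < mu) by (unfold mu; lra).
assert (at0 : forall n m, A n m 0 = d n m).
{ apply (jet_relation_unique sg (fun n m => A n m 0) d); auto.
  intros [|[|[|[|n]]]] m hn; try lia.
  - rewrite A0, evd; auto. now exists 0%nat.
  - now rewrite A1.
  - rewrite A2, evd; auto. now exists 1%nat.
  - now rewrite A3. }
assert (atT : forall n m, A n m T = dT n m).
{ apply (jet_relation_unique sg (fun n m => A n m T) dT); auto.
  intros [|[|[|[|n]]]] m hn; try lia.
  - rewrite A0, evdT; auto. now exists 0%nat.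
  - now rewrite A1.
  - rewrite A2, evdT; auto. now exists 1%nat.
  - now rewrite A3. }
set (Y := jet_series A).
assert (hY : bitower 0 1 0 T Y) by (apply bitower_jet_series with e lam mu; auto; lra).
set (y := Y 0%nat 0%nat).
assert (hy : agrees_on_box 0 1 0 T y (Y 0%nat 0%nat)) by (intros x t _ _; reflexivity).
assert (h01 : 0 < 1) by lra.
assert (hyx := fun n => partial_n_x_agrees 0 1 0 T Y y 0 0 n h01 hY hy).
assert (hyt := fun n => partial_n_t_agrees 0 1 0 T Y y 0 0 n hT hY hy).
assert (seg0 : seg 0 1 0) by (unfold seg; lra).
assert (seg1 : seg 0 1 1) by (unfold seg; lra).
assert (segT0 : seg 0 T 0) by (unfold seg; lra).
assert (segTT : seg 0 T T) by (unfold seg; lra).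
assert (hu : forall x, seg 0 1 x -> Rabs x <= 1).
{ intros z [h0 h1]. now rewrite Rabs_pos_eq. }
set (L := / (1 - 1 / lam)). assert (hL : 0 < L) by (unfold L, lam; lra).
assert (hL2 : 0 < 16 * L ^ 2) by (generalize (pow_lt L 2 hL); lra).
assert (hr1 : 0 < lam / (2 * L)) by (apply Rdiv_lt_0_compat; lra).
assert (hr2 : 0 < mu / (16 * L ^ 2)) by (apply Rdiv_lt_0_compat; lra).
assert (bY : forall p m x t, seg 0 1 x -> seg 0 T t -> Rabs (Y p m x t) <=
   e * L * factR p * (factR m * factR m) / ((lam / (2 * L)) ^ p * (mu / (16 * L ^ 2)) ^ m)).
{ intros p m x t hx ht. apply Rle_trans with (jet_sum_bound e lam mu p m).
  - apply jet_series_bound with T; auto; lra.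
  - now apply jet_sum_bound_gevrey. }
assert (trace : forall p, gevrey 2 0 T (Y p 0%nat 1)).
{ intros p. assert (hrp := pow_lt _ p hr1). assert (hfp := factR_pos p).
  apply (gevrey2_of_tower T (e * L * factR p / (lam / (2 * L)) ^ p) (mu / (16 * L ^ 2))
    (fun m => Y p m 1)); auto.
  - apply Rdiv_lt_0_compat; auto. repeat apply Rmult_lt_0_compat; lra.
  - apply tower_jet_series with e lam mu; auto; lra.
  - intros m t ht. apply Rle_trans with (1 := bY p m 1 t seg1 ht).
    assert (hrm := pow_lt _ m hr2).
    set (w1 := (lam / (2 * L)) ^ p) in *. set (w2 := (mu / (16 * L ^ 2)) ^ m) in *.
    right. field. lra. }
exists y, (Y 0%nat 0%nat 1), (Y 2%nat 0%nat 1).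
split; [|split; [|split; [|split; [|split; [|split]]]]]; auto.
- split.
  + intros k. now apply Ck_box_agrees with Y 0%nat 0%nat.
  + exists (e * L), (lam / (2 * L)), (mu / (16 * L ^ 2)).
    split; [now apply Rmult_lt_0_compat|]. split; [auto|]. split; [auto|].
    intros p1 p2 x t hx ht.
    rewrite (partial_n_x_agrees 0 1 0 T Y _ 0 (p2 + 0) p1 h01 hY (hyt p2) x t hx ht).
    rewrite !Nat.add_0_r, Rpower_factR_2, Rpower_1 by apply (factR_pos p1).
    now apply bY.
- intros x t hx ht. rewrite (hyt 2%nat x t), (hyx 4%nat x t), (hyx 2%nat x t) by auto.
  replace (partial_x 0 1 (fun x' t' => y x' t' ^ 2) x t) with (2 * (y x t * Y 1%nat 0%nat x t)).
  + apply (jet_series_equation T e lam mu sg A x t); auto; lra.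
  + symmetry. destruct hY as [hYx _].
    apply derive_on_congr with (fun x => y x t * y x t); auto.
    { intros s _. simpl. ring. }
    apply D_in_congr with (f := fun x => y x t * y x t)
      (l := Y 1%nat 0%nat x t * y x t + y x t * Y 1%nat 0%nat x t); auto; [ring|].
    exact (Dmult (seg 0 1) _ _ _ _ x (hYx 0%nat 0%nat x t hx ht) (hYx 0%nat 0%nat x t hx ht)).
- intros t ht. rewrite !(hyx 2%nat) by auto.
  assert (hz : forall p, (forall m t, A p m t = 0) -> Y p 0%nat 0 t = 0).
  { intros p hp. unfold Y, jet_series. rewrite PSeries_0. simpl (0 + p)%nat.
    rewrite hp. unfold Rdiv. ring. }
  repeat split; auto. exact (hz 0%nat A0).
- intros x hx. split.
  + apply jet_series_at with (fun n => d n 0%nat); auto.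
  + change (partial_t 0 T y x 0) with (partial_n_t 0 T 1 y x 0).
    rewrite (hyt 1%nat x 0) by auto. apply jet_series_at with (fun n => d n 1%nat); auto.
- intros x hx. split.
  + apply jet_series_at with (fun n => dT n 0%nat); auto.
  + change (partial_t 0 T y x T) with (partial_n_t 0 T 1 y x T).
    rewrite (hyt 1%nat x T) by auto. apply jet_series_at with (fun n => dT n 1%nat); auto.
Qed.
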